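(* Let $P\subset\mathbb{H}^n$ be a finite-volume quasi-arithmetic Coxeter polytope with ground field $\mathbb{F}=\mathbb{F}(P)$, and let $P'$ be a $k$-dimensional face of $P$ with $2\le k\le n-1$. If $P'$ (regarded as a polytope in the $k$-dimensional hyperbolic space spanned by it) is itself a Coxeter polytope, then $P'$ is a quasi-arithmetic Coxeter polytope with ground field $\mathbb{F}(P')=\mathbb{F}$.
   Context: Use the hyperboloid model: $\mathbb{E}^{n,1}$ is $\mathbb{R}^{n+1}$ with a symmetric bilinear form $(\cdot,\cdot)$ of signature $(n,1)$, and $\mathbb{H}^n=\{v:(v,v)=-1\}$ intersected with one sheet of the cone $\{(v,v)<0\}$. For $e$ with $(e,e)=1$ let $H_e=\{x\in\mathbb{H}^n:(x,e)=0\}$ and $H_e^-=\{x:(x,e)\le 0\}$. A finite-volume convex polytope is written irredundantly as $P=\bigcap_{j=0}^N H_{e_j}^-$; its Gram matrix is $G(P)=(g_{ij})=((e_i,e_j))_{i,j=0}^N$. $P$ is acute-angled if all its dihedral angles are $\le\pi/2$; it is a Coxeter polytope if any two intersecting bounding hyperplanes meet at dihedral angle $\pi/m$ with $m\ge2$ an integer. A face of $P$ is itself a polytope in the lower-dimensional hyperbolic space it spans, bounded by its intersections with the adjacent facets of $P$, and has its own Gram matrix (computed from unit normals inside that subspace). Set $\widetilde{\mathbb{F}}(P)=\mathbb{Q}(\{g_{ij}\})$ and $\mathbb{F}(P)=\mathbb{Q}(\mathrm{Cyc}(G(P)))$, where $\mathrm{Cyc}(A)$ is the set of cyclic products $a_{i_1i_2}a_{i_2i_3}\cdots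 a_{i_ki_1}$ of entries of $A$; $\mathbb{F}(P)$ is the ground field of $P$. A finite-volume acute-angled polytope $P$ is quasi-arithmetic if (V1) $\widetilde{\mathbb{F}}(P)$ is a totally real algebraic number field, and (V2) for every embedding $\sigma:\widetilde{\mathbb{F}}(P)\to\mathbb{R}$ with $\sigma|_{\mathbb{F}(P)}\neq\mathrm{Id}$, the matrix $G(P)^\sigma$ (entrywise $\sigma$) is positive semi-definite. (For Coxeter polytopes this is equivalent, by Vinberg's criterion, to the reflection group of $P$ being quasi-arithmetic.) *)

(* Defs.v *)
From HB Require Import structures.
From mathcomp Require Import all_boot all_order all_algebra.
From mathcomp Require Import all_classical all_reals all_analysis.
From mathcomp Require complex.
Import complex.ComplexField.

Set Implicit Arguments.
Unset Strict Implicit.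
Unset Printing Implicit Defensive.

Import Order.TTheory GRing.Theory Num.Theory.
Local Open Scope ring_scope.

Definition lor {R : realType} {n : nat} (x y : 'rV[R]_n.+1) : R :=
  \sum_(i < n.+1) (if i == ord_max then - (x 0 i * y 0 i) else x 0 i * y 0 i).

Definition Hyp {R : realType} {n : nat} (x : 'rV[R]_n.+1) : Prop :=
  lor x x = -1 /\ 0 < x 0 ord_max.

Section Polytopes.
Context {R : realType} {n : nat} {T : finType}.
Implicit Types (f : T -> 'rV[R]_n.+1).

Definition polyset f (x : 'rV[R]_n.+1) : Prop :=
  Hyp x /\ forall j, lor x (f j) <= 0.

Definition unit_normals f : Prop := forall j, lor (f j) (f j) = 1.

Definition has_interior f : Prop :=
  exists x, Hyp x /\ forall j, lor x (f j) < 0.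

Definition irredundant f : Prop :=
  forall j, exists x, Hyp x /\ 0 < lor x (f j) /\
                      forall i, i != j -> lor x (f i) <= 0.

Definition convex_polytope f : Prop :=
  [/\ unit_normals f, has_interior f & irredundant f].

Definition gram f (i j : T) : R := lor (f i) (f j).

Definition dihedral f (i j : T) : R := acos (- gram f i j).

(* facets i, j are adjacent: they meet along a codimension-2 face of P *)
Definition adjacent f (i j : T) : Prop :=
  i != j /\ exists x, [/\ polyset f x, lor x (f i) = 0, lor x (f j) = 0 &
                         forall l, l != i -> l != j -> lor x (f l) < 0].

Definition acute_angled f : Prop :=
  forall i j, adjacent f i j -> dihedral f i j <= pi / 2.

Definition hyperplanes_meet f (i j : T) : Prop :=
  exists x, [/\ Hyp x, lor x (f i) = 0 & lor x (f j) = 0].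

Definition coxeter_angles f : Prop :=
  forall i j, i != j -> hyperplanes_meet f i j ->
    exists m : nat, (2 <= m)%N /\ dihedral f i j = pi / m%:R.

End Polytopes.

(* Hyperbolic volume.  Chart R^n -> H^n, y |-> (y, sqrt(1+|y|^2)); the       *)
(* Riemannian volume element of H^n in this chart is dy / sqrt(1+|y|^2).    *)
(* n-dimensional Lebesgue integrals of nonnegative functions are written as *)
(* iterated integrals (equal to the product-measure integral by Tonelli).   *)
Fixpoint iter_int {R : realType} (d : nat) (F : seq R -> \bar R) : \bar R :=
  match d with
  | 0 => F [::]
  | d'.+1 => (\int[@lebesgue_measure R]_(t in [set: R]) iter_int d' (fun s => F (t :: s)))%E
  end.

Definition chart_pt {R : realType} {n : nat} (s : seq R) : 'rV[R]_n.+1 :=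
  \row_(i < n.+1) (if i == ord_max then Num.sqrt (1 + \sum_(t <- s) t ^+ 2)
                   else nth 0 s i).

Definition hvol {R : realType} (n : nat) (A : 'rV[R]_n.+1 -> Prop) : \bar R :=
  iter_int n (fun s => if `[< A (chart_pt s) >]
                       then ((Num.sqrt (1 + \sum_(t <- s) t ^+ 2))^-1)%:E
                       else 0%E).

Definition finite_volume {R : realType} {n : nat} {T : finType}
  (f : T -> 'rV[R]_n.+1) : Prop := (hvol (polyset f) < +oo)%E.

Definition coxeter_polytope {R : realType} {n : nat} {T : finType}
  (f : T -> 'rV[R]_n.+1) : Prop :=
  [/\ convex_polytope f, finite_volume f & coxeter_angles f].

Section Fields.
Context {R : realType}.

Definition is_subfield (K : R -> Prop) : Prop :=
  [/\ K 0, K 1,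
      (forall x y, K x -> K y -> [/\ K (x + y), K (- x) & K (x * y)]) &
      (forall x, K x -> x != 0 -> K x^-1)].

Definition gen_field (S : R -> Prop) (x : R) : Prop :=
  forall K, is_subfield K -> (forall s, S s -> K s) -> K x.

Definition is_number_field (K : R -> Prop) : Prop :=
  exists (d : nat) (b : 'I_d -> R), (forall i, K (b i)) /\
    forall x, K x -> exists q : 'I_d -> rat, x = \sum_(i < d) ratr (q i) * b i.

Definition field_emb {L : nzRingType} (K : R -> Prop) (s : R -> L) : Prop :=
  s 1 = 1 /\ forall x y, K x -> K y -> s (x + y) = s x + s y /\ s (x * y) = s x * s y.

Definition totally_real (K : R -> Prop) : Prop :=
  is_number_field K /\
  forall s : R -> complex.complex R, field_emb K s ->
    forall x, K x -> complex.Im (s x) = 0.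

End Fields.

Section Quasi.
Context {R : realType} {n : nat} {T : finType}.
Implicit Types (f : T -> 'rV[R]_n.+1).

Definition cyc_prod (g : T -> T -> R) (s : seq T) : R :=
  \prod_(p <- zip s (rot 1 s)) g p.1 p.2.

Definition Cyc f (x : R) : Prop :=
  exists s : seq T, s != [::] /\ x = cyc_prod (gram f) s.

Definition Ftilde f : R -> Prop := gen_field (fun x => exists i j, x = gram f i j).
Definition ground_field f : R -> Prop := gen_field (Cyc f).

Definition psd (A : T -> T -> R) : Prop :=
  forall c : T -> R, 0 <= \sum_(i : T) \sum_(j : T) c i * A i j * c j.

Definition quasi_arithmetic f : Prop :=
  [/\ convex_polytope f, finite_volume f, acute_angled f,
      totally_real (Ftilde f) &
      forall s : R -> R, field_emb (Ftilde f) s ->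
        (exists x, ground_field f x /\ s x != x) ->
        psd (fun i j => s (gram f i j))].

End Quasi.

Section Faces.
Context {R : realType} {n m : nat}.

Definition face_set (e : 'I_m -> 'rV[R]_n.+1) (I : {set 'I_m}) (x : 'rV[R]_n.+1)
  : Prop := polyset e x /\ forall i, i \in I -> lor x (e i) = 0.

Definition span_dim (A : 'rV[R]_n.+1 -> Prop) (d : nat) : Prop :=
  exists X : 'M[R]_(d, n.+1), [/\ forall i, A (row i X), \rank X = d &
                                  forall x, A x -> (x <= X)%MS].

(* indices j of the facets of P cutting out the facets ((k-1)-faces)
   of the k-dimensional face (face_set e I) *)
Definition face_facets (e : 'I_m -> 'rV[R]_n.+1) (I : {set 'I_m}) (k : nat)
  : {set 'I_m} :=
  finset (fun j => (j \notin I) &&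
    `[< span_dim (fun x => face_set e I x /\ lor x (e j) = 0) k >]).
End Faces.

(* An isometric embedding E^{k,1} -> E^{n,1}, u |-> u *m M, sending H^k into
   H^n, whose image contains (hence, by dimension, equals the span of) A:
   it identifies the hyperbolic k-space spanned by A with H^k. *)
Definition chart_of {R : realType} {n k : nat} (M : 'M[R]_(k.+1, n.+1))
  (A : 'rV[R]_n.+1 -> Prop) : Prop :=
  [/\ forall u v : 'rV[R]_k.+1, lor (u *m M) (v *m M) = lor u v,
      forall u : 'rV[R]_k.+1, Hyp u -> Hyp (u *m M) &
      forall x, A x -> (x <= M)%MS].

(* f is the outward unit normal, inside the subspace (read in the chart M),
   of the hyperplane H_e: (f,f) = 1 and (f,u) is a positive multiple of
   (e, u M) for all u *)
Definition face_normal {R : realType} {n k : nat} (M : 'M[R]_(k.+1, n.+1))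
  (e : 'rV[R]_n.+1) (f : 'rV[R]_k.+1) : Prop :=
  lor f f = 1 /\ exists c : R, 0 < c /\ forall u, lor f u = c * lor e (u *m M).

(* Main.v *)
(** The unit normal of a facet of the face is the normalised orthogonal
    projection of the corresponding [e j] along the span of the [e b] whose
    hyperplanes contain the face. Walking along the Gram graph rescales the
    [e b] so that their Gram matrix has entries in the ground field [F]; the
    projection is then the solution of a linear system over [F], so the Gram
    matrix of the face is [q i * q j * P i j] with [P] over [F] and
    [q j ^+ 2 = (P j j)^-1]. Hence [F(P')] is contained in [F]. An embedding of
    the field generated by the Gram matrix of [P] and the [q j] is real: either
    it fixes [F], or it makes the Gram matrix of [P], hence [P i j],
    semidefinite. This gives both conditions of quasi-arithmeticity. If
    [F(P')] were smaller than [F], some embedding would fix [F(P')] and move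
    [F]; the Gram matrix of the face would be semidefinite, and a polytope
    with semidefinite Gram matrix has infinite volume. *)

Require Import Defs.
From HB Require Import structures.
From mathcomp Require Import all_boot all_order all_algebra.
From mathcomp Require Import all_classical all_reals all_analysis.
From mathcomp Require complex.
From mathcomp Require Import ring lra zify.
Import complex.ComplexField.
Import (canonicals) complex.

Set Implicit Arguments.
Unset Strict Implicit.
Unset Printing Implicit Defensive.
Import Order.TTheory GRing.Theory Num.Theory.
Local Open Scope ring_scope.

(** * Subfields and their embeddings *)

(** The proof [hL] is a parameter so that the closure instance below can be inferred from the
    predicate itself. *)
Definition subfield_pred (R : realType) (L : R -> Prop) (hL : is_subfield L) :
  {pred R} := fun x => `[< L x >].

Lemma in_subfield_pred (R : realType) (L : R -> Prop) (hL : is_subfield L) x :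
  reflect (L x) (x \in subfield_pred hL).
Proof. by rewrite unfold_in; exact: asboolP. Qed.

Lemma subfield_pred_divring (R : realType) (L : R -> Prop)
  (hL : is_subfield L) : divring_closed (subfield_pred hL).
Proof.
case: (hL) => L0 L1 Lop Linv; split=> [|x y|x y];
  first exact/in_subfield_pred.
- move=> /in_subfield_pred Lx /in_subfield_pred Ly; apply/in_subfield_pred.
  by have [_ LN _] := Lop y y Ly Ly; have [] := Lop x (- y) Lx LN.
- move=> /in_subfield_pred Lx /in_subfield_pred Ly; apply/in_subfield_pred.
  have [->|y0] := eqVneq y 0; first by rewrite invr0 mulr0.
  by have [] := Lop x y^-1 Lx (Linv y Ly y0).
Qed.

HB.instance Definition _ (R : realType) (L : R -> Prop) (hL : is_subfield L) :=
  GRing.isDivringClosed.Build R (subfield_pred hL) (subfield_pred_divring hL).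

(** Turns a propositional subfield into a field type, over which polynomials and matrices can be
    formed. *)
Record subfield_type (R : realType) (L : R -> Prop) (hL : is_subfield L) :=
  SubfieldElt { subfield_val :> R; _ : subfield_val \in subfield_pred hL }.

HB.instance Definition _ (R : realType) (L : R -> Prop) (hL : is_subfield L) :=
  [isSub for @subfield_val R L hL].
HB.instance Definition _ (R : realType) (L : R -> Prop) (hL : is_subfield L) :=
  [Choice of subfield_type hL by <:].
HB.instance Definition _ (R : realType) (L : R -> Prop) (hL : is_subfield L) :=
  [SubChoice_isSubIntegralDomain of subfield_type hL by <:].
HB.instance Definition _ (R : realType) (L : R -> Prop) (hL : is_subfield L) :=
  [SubIntegralDomain_isSubField of subfield_type hL by <:].

HB.instance Definition _ (R : realType) (L : R -> Prop) (hL : is_subfield L) :=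
  GRing.isZmodMorphism.Build _ _ (@subfield_val R L hL) (rmorphB val).
HB.instance Definition _ (R : realType) (L : R -> Prop) (hL : is_subfield L) :=
  GRing.isMonoidMorphism.Build _ _ (@subfield_val R L hL)
    (rmorph1 val, rmorphM val).

Lemma subfield_typeE (R : realType) (L : R -> Prop) (hL : is_subfield L) x :
  L x -> exists y : subfield_type hL, val y = x.
Proof. by move=> /(in_subfield_pred hL) Lx; exists (SubfieldElt Lx). Qed.

Lemma subfield_typeP (R : realType) (L : R -> Prop) (hL : is_subfield L)
  (x : subfield_type hL) : L (val x).
Proof. exact/(in_subfield_pred hL)/valP. Qed.

Section SubfieldClosure.
Variables (R : realType) (L : R -> Prop).
Hypothesis hL : is_subfield L.

Lemma subfield0 : L 0. Proof. by case: hL. Qed.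
Lemma subfield1 : L 1. Proof. by case: hL. Qed.
Lemma subfieldD x y : L x -> L y -> L (x + y).
Proof. by case: hL => _ _ h _ Lx Ly; case: (h x y Lx Ly). Qed.
Lemma subfieldN x : L x -> L (- x).
Proof. by case: hL => _ _ h _ Lx; case: (h x x Lx Lx). Qed.
Lemma subfieldM x y : L x -> L y -> L (x * y).
Proof. by case: hL => _ _ h _ Lx Ly; case: (h x y Lx Ly). Qed.
Lemma subfieldB x y : L x -> L y -> L (x - y).
Proof. by move=> Lx Ly; apply/subfieldD/subfieldN. Qed.
Lemma subfieldV x : L x -> L x^-1.
Proof.
have [-> L0|x0] := eqVneq x 0; first by rewrite invr0.
by case: hL => _ _ _ h Lx; exact: h.
Qed.
Lemma subfieldX x n : L x -> L (x ^+ n).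
Proof.
move=> Lx; elim: n => [|n IH]; first by rewrite expr0; exact: subfield1.
by rewrite exprS; exact: subfieldM.
Qed.
Lemma subfield_sum (I : Type) (r : seq I) (P : pred I) (F : I -> R) :
  (forall i, L (F i)) -> L (\sum_(i <- r | P i) F i).
Proof.
by move=> h; elim/big_ind: _ => // *; [exact: subfield0 | exact: subfieldD].
Qed.

Lemma subfield_prod (I : Type) (r : seq I) (P : pred I) (F : I -> R) :
  (forall i, L (F i)) -> L (\prod_(i <- r | P i) F i).
Proof.
by move=> h; elim/big_ind: _ => // *; [exact: subfield1 | exact: subfieldM].
Qed.

Lemma subfield_rat (q : rat) : L (ratr q).
Proof.
suff -> : ratr q = val (ratr q : subfield_type hL) by exact: subfield_typeP.
by rewrite fmorph_rat.
Qed.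

Section Embedding.
Variables (C : fieldType) (s : R -> C).
Hypothesis hs : field_emb L s.

Lemma embD x y : L x -> L y -> s (x + y) = s x + s y.
Proof. by move=> Lx Ly; have [] := hs.2 x y Lx Ly. Qed.
Lemma embM x y : L x -> L y -> s (x * y) = s x * s y.
Proof. by move=> Lx Ly; have [] := hs.2 x y Lx Ly. Qed.
Lemma emb1 : s 1 = 1. Proof. exact: hs.1. Qed.
Lemma emb0 : s 0 = 0.
Proof.
have := embD subfield0 subfield0; rewrite addr0 => /eqP.
by rewrite -subr_eq0 opprD addrA subrr sub0r oppr_eq0 => /eqP.
Qed.
Lemma embN x : L x -> s (- x) = - s x.
Proof.
move=> Lx; apply/eqP; rewrite -addr_eq0 -embD // ?subrr ?addNr ?emb0 //.
exact: subfieldN.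
Qed.
Lemma emb_sum (I : Type) (r : seq I) (P : pred I) (F : I -> R) :
  (forall i, L (F i)) ->
  s (\sum_(i <- r | P i) F i) = \sum_(i <- r | P i) s (F i).
Proof.
move=> h; elim: r => [|i r IH]; first by rewrite !big_nil emb0.
rewrite !big_cons; case: (P i); rewrite // embD // ?IH //.
exact: subfield_sum.
Qed.
Lemma emb_eq0 x : L x -> s x = 0 -> x = 0.
Proof.
move=> Lx sx; apply/eqP; apply: contraT => x0.
have := emb1; rewrite -(mulfV x0) embM //; last exact: subfieldV.
by rewrite sx mul0r => /eqP; rewrite eq_sym oner_eq0.
Qed.
Lemma embV x : L x -> s x^-1 = (s x)^-1.
Proof.
move=> Lx; have [->|x0] := eqVneq x 0; first by rewrite invr0 emb0 invr0.
have sx0 : s x != 0 by apply: contra_neq x0; exact: emb_eq0.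
apply: (mulfI sx0); rewrite mulfV // -embM ?mulfV ?emb1 //.
exact: subfieldV.
Qed.

(** A [field_emb] is constrained only on [L]; on the bundled field it becomes a morphism that can be
    mapped over polynomials. *)
Lemma emb_rmorphism : exists phi : {rmorphism subfield_type hL -> C},
  forall x, phi x = s (val x).
Proof.
pose phi (x : subfield_type hL) := s (val x).
have phiB : zmod_morphism phi.
  move=> x y; rewrite /phi rmorphB embD ?embN //;
    do ?[exact: subfield_typeP | apply: subfieldN].
have phiM : monoid_morphism phi.
  split=> [|x y]; rewrite /phi ?rmorph1 ?emb1 // rmorphM embM //;
    exact: subfield_typeP.
pose a := GRing.isZmodMorphism.Build _ _ phi phiB.
pose b := GRing.isMonoidMorphism.Build _ _ phi phiM.
pose phi' : {rmorphism _ -> _} := HB.pack phi a b.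
by exists phi'.
Qed.

End Embedding.

End SubfieldClosure.

Lemma field_emb_sub (R : realType) (C : fieldType) (K L : R -> Prop)
  (s : R -> C) : (forall x, K x -> L x) -> field_emb L s -> field_emb K s.
Proof. by move=> KL [s1 sL]; split=> // x y Kx Ky; apply: sL; exact: KL. Qed.

(** * Simple algebraic extensions of a subfield *)

(** Take a nonzero polynomial of least size vanishing at [x]: the remainder modulo it of any
    polynomial vanishing at [x] also vanishes there, hence is zero. *)
Lemma minimal_poly (F E : fieldType) (iota : {rmorphism F -> E}) (x : E) :
  algebraicOver iota x -> exists mp : {poly F}, mp != 0 /\
    forall p, root (map_poly iota p) x = (mp %| p).
Proof.
move=> [p p0 px].
pose Q n := `[< exists q : {poly F}, [/\ q != 0, size q = n &
  root (map_poly iota q) x] >].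
have exQ : exists n, Q n by exists (size p); apply/asboolP; exists p.
case: (ex_minnP exQ) => n /asboolP[mp [mp0 sz mpx]] nmin.
exists mp; split=> // q; apply/idP/idP => [qx|/dvdpP[r ->]]; last first.
  by rewrite rmorphM rootM mpx orbT.
apply: contraT => ndiv; have r0 : q %% mp != 0 by rewrite -/(dvdp mp q).
have : ~~ (size (q %% mp)%R < size mp)%N; last by rewrite ltn_modp mp0.
rewrite -leqNgt sz; apply/nmin/asboolP; exists (q %% mp); split=> //.
move: qx; rewrite {1}(divp_eq q mp) rmorphD rmorphM /= /root hornerD hornerM.
by rewrite (eqP mpx) mulr0 add0r.
Qed.

(** Polynomial values suffice, without fractions: for algebraic [x] they already form a field. *)
Definition adjoin (R : realType) (L : R -> Prop) (hL : is_subfield L) (x : R)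
  (z : R) : Prop :=
  exists p : {poly subfield_type hL}, z = (map_poly val p).[x].

Lemma algebraicOver_subfield (R : realType) (L : R -> Prop)
  (hL : is_subfield L) (x : R) : algebraicOver (ratr : rat -> R) x ->
  algebraicOver (val : subfield_type hL -> R) x.
Proof.
move=> [p p0 px]; pose q : {poly subfield_type hL} := map_poly ratr p.
have qE : map_poly val q = map_poly (ratr : rat -> R) p.
  have r0 : (ratr 0 : subfield_type hL) = 0.
    by apply: val_inj; rewrite fmorph_rat !rmorph0.
  apply/polyP => i; rewrite coef_map [RHS]coef_map /q coef_map_id0 //.
  exact: (fmorph_rat val).
exists q; last by rewrite qE.
by rewrite -(map_poly_eq0 val) qE map_poly_eq0.
Qed.

Section Adjoin.
Variables (R : realType) (L : R -> Prop).
Hypothesis hL : is_subfield L.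
Variable x : R.

Lemma adjoin_gen : adjoin hL x x.
Proof. by exists 'X; rewrite map_polyX hornerX. Qed.

Lemma adjoin_base z : L z -> adjoin hL x z.
Proof.
move=> /(subfield_typeE hL)[y <-]; exists y%:P.
by rewrite map_polyC hornerC.
Qed.

Lemma adjoin_min (K : R -> Prop) : is_subfield K -> (forall z, L z -> K z) ->
  K x -> forall z, adjoin hL x z -> K z.
Proof.
move=> hK LK Kx z [p ->]; rewrite horner_coef; apply: subfield_sum => // i.
apply: subfieldM => //; last exact: subfieldX.
by rewrite coef_map; apply: LK; exact: subfield_typeP.
Qed.

Hypothesis xalg : algebraicOver (ratr : rat -> R) x.

Lemma adjoin_subfield : is_subfield (adjoin hL x).
Proof.
have [mp [mp0 mpP]] := minimal_poly (algebraicOver_subfield hL xalg).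
split.
- by exists 0; rewrite rmorph0 horner0.
- by exists 1; rewrite rmorph1 hornerC.
- move=> _ _ [p ->] [q ->]; split.
  + by exists (p + q); rewrite rmorphD hornerD.
  + by exists (- p); rewrite rmorphN hornerN.
  + by exists (p * q); rewrite rmorphM hornerM.
- move=> _ [p ->] px0.
  (* Here [mp] is [h] times the gcd. If the gcd is not constant, [h] is too small to vanish at [x],
     so the gcd does, and with it [p]. *)
  have : coprimep p mp.
    rewrite coprimep_def; apply: contraNT px0 => szg.
    have /dvdpP[h mpE] := dvdp_gcdr p mp.
    have h0 : h != 0 by apply: contra_neq mp0 => h0; rewrite mpE h0 mul0r.
    have g0 : gcdp p mp != 0.
      by apply: contra_neq mp0 => g0; rewrite mpE g0 mulr0.
    have : root (map_poly val mp) x by rewrite mpP.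
    rewrite {1}mpE rmorphM rootM /= mpP => /orP[/dvdp_leq|].
      have gs : (0 < size (gcdp p mp))%N by rewrite size_poly_gt0.
      have hs : (0 < size h)%N by rewrite size_poly_gt0.
      move=> /(_ h0); rewrite {1}mpE size_mul //.
      move=> le; exfalso; move: le szg gs hs.
      move: (size h) (size (gcdp p mp)) => a b; clear; lia.
    rewrite mpP => /(dvdp_trans)/(_ (dvdp_gcdl p mp)).
    by rewrite -mpP.
  (* Evaluating the Bezout relation at [x] kills the [mp] term. The relation holds up to the scalars
     [a] and [b], so the inverse is a rescaled value of [u]. *)
  case/Bezout_coprimepP => -[u v] /= uv.
  have /eqpP[[a b] /= /andP[a0 b0] E] := uv.
  have mpx : (map_poly val mp).[x] = 0 by apply/eqP; rewrite -/(root _ x) mpP.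
  have := congr1 (fun P => (map_poly val P).[x]) E.
  rewrite !map_polyZ !hornerZ rmorphD /= hornerD !rmorphM /= !hornerM mpx.
  rewrite mulr0 addr0 rmorph1 hornerC mulr1 => E'.
  exists ((b^-1 * a) *: u); apply: (mulIf px0); rewrite mulVf //.
  have -> : (map_poly val ((b^-1 * a) *: u)).[x] =
      (val b)^-1 * val a * (map_poly val u).[x].
    by rewrite map_polyZ hornerZ rmorphM fmorphV.
  set U := (map_poly val u).[x]; set P := (map_poly val p).[x].
  have E'' : val a * (U * P) = val b := E'.
  by rewrite -!mulrA E'' mulVf // fmorph_eq0.
Qed.

(** The value of [p] at [x] is sent to the value of its image at [y]. This is well defined because
    polynomials with the same value at [x] differ by a multiple of [mp]. *)
Lemma adjoin_emb_root (C : fieldType) (s : R -> C)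
  (phi : {rmorphism subfield_type hL -> C})
  (mp : {poly subfield_type hL}) (y : C) :
  (forall z, phi z = s (val z)) ->
  (forall p, root (map_poly val p) x = (mp %| p)) ->
  root (map_poly phi mp) y ->
  exists s' : R -> C, [/\ field_emb (adjoin hL x) s',
    (forall z, L z -> s' z = s z) & s' x = y].
Proof.
move=> phiE mpP mpy.
(* A representing polynomial is picked by choice; outside the extension the default value is 0. *)
pose s' z := if pselect (adjoin hL x z) is left h
  then (map_poly phi (projT1 (cid h))).[y] else 0.
have s'E p : s' (map_poly val p).[x] = (map_poly phi p).[y].
  rewrite /s'; case: pselect => [h|[]]; last by exists p.
  case: cid => q /= pq; apply/eqP; rewrite -subr_eq0 -hornerN -hornerD.
  rewrite -rmorphN -rmorphD /= -/(root _ y).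
  have /dvdpP[r ->] : mp %| q - p.
    by rewrite -mpP /root rmorphB hornerD hornerN -pq subrr.
  by rewrite rmorphM rootM mpy orbT.
exists s'; split; last 2 first.
- move=> z /(subfield_typeE hL)[z' <-]; have := s'E z'%:P.
  by rewrite !map_polyC !hornerC => ->; exact: phiE.
- by have := s'E 'X; rewrite !map_polyX !hornerX.
split; first by have := s'E 1; rewrite !rmorph1 !hornerC.
move=> _ _ [p ->] [q ->]; split.
  by rewrite -hornerD -rmorphD !s'E rmorphD hornerD.
by rewrite -hornerM -rmorphM !s'E rmorphM hornerM.
Qed.

(** The minimal polynomial is not constant, so its image has a root in the closed field, to which
    [x] can be sent. *)
Lemma adjoin_emb (C : closedFieldType) (s : R -> C) : field_emb L s ->
  exists s' : R -> C, field_emb (adjoin hL x) s' /\ forall z, L z -> s' z = s z.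
Proof.
move=> hs; have [phi phiE] := emb_rmorphism hL hs.
have [mp [mp0 mpP]] := minimal_poly (algebraicOver_subfield hL xalg).
have /closed_rootP[y yroot] : size (map_poly phi mp) != 1%N.
  rewrite size_map_poly; apply/eqP => /eqP/size_poly1P[c c0 mpE].
  have : root (map_poly val mp) x by rewrite mpP.
  by rewrite mpE map_polyC rootC fmorph_eq0 (negPf c0).
by have [s' [? ? _]] := adjoin_emb_root phiE mpP yroot; exists s'.
Qed.

(* The derivative of the minimal polynomial does not vanish at [x], so the
   cofactor of ['X - x] is nonconstant and has a root other than [x]. *)
Lemma adjoin_emb_move (C : closedFieldType) (iota : {rmorphism R -> C}) :
  ~ L x -> exists s' : R -> C, [/\ field_emb (adjoin hL x) s',
    (forall z, L z -> s' z = iota z) & s' x != iota x].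
Proof.
move=> nLx; have [mp [mp0 mpP]] := minimal_poly (algebraicOver_subfield hL xalg).
pose phi : {rmorphism subfield_type hL -> C} := iota \o val.
have mpx : root (map_poly phi mp) (iota x).
  by rewrite map_poly_comp fmorph_root mpP.
(* A minimal polynomial of degree at most 1 would put [x] in [L]. *)
have sz2 : (2 < size mp)%N.
  rewrite ltnNge; apply/negP => sz; apply: nLx.
  have : root (map_poly val mp) x by rewrite mpP.
  have mpE : mp = mp`_1 *: 'X + (mp`_0)%:P.
    apply/polyP => -[|[|i]]; rewrite !coefE /= ?mulr0 ?mulr1 ?add0r ?addr0 //.
    by rewrite nth_default // (leq_trans sz).
  have mp1 : mp`_1 != 0.
    apply: contra_neq mp0 => m1; have := mpE; rewrite m1 scale0r add0r => mpE'.
    have : root (map_poly val mp) x by rewrite mpP.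
    rewrite mpE' map_polyC rootC fmorph_eq0 => /eqP ->; exact: polyC0.
  rewrite mpE rmorphD /= map_polyZ map_polyX map_polyC /root hornerD hornerZ.
  rewrite hornerX hornerC addr_eq0 => /eqP xE.
  have -> : x = val (- (mp`_0) / mp`_1).
    by rewrite fmorph_div rmorphN -xE mulrC mulKf // fmorph_eq0.
  exact: subfield_typeP.
have [q qE] := factor_theorem _ _ mpx.
have dE : (map_poly phi mp)^`().[iota x] = q.[iota x].
  by rewrite qE derivM derivXsubC mulr1 hornerD hornerM hornerXsubC subrr
     mulr0 add0r.
have qx : ~~ root q (iota x).
  rewrite /root -dE deriv_map map_poly_comp horner_map fmorph_eq0.
  rewrite -/(root _ x) mpP; apply/negP => /dvdp_leq le.
  have m0 : mp^`() != 0.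
    apply: contra_neq mp0 => d0; apply/eqP; rewrite -lead_coef_eq0.
    have := congr1 (fun p : {poly subfield_type hL} => val p`_(size mp).-2) d0.
    rewrite /= coef_deriv coef0 rmorphMn rmorph0 => /eqP.
    have -> : (size mp).-2.+1 = (size mp).-1 by move: sz2; case: (size mp) => [|[]].
    rewrite mulrn_eq0 fmorph_eq0 /lead_coef => /orP[/eqP s1|//].
    by move: sz2; move: s1; case: (size mp) => [|[]].
  have := le m0; rewrite leqNgt => /negP[]; exact: lt_size_deriv.
have /closed_rootP[y qy] : size q != 1%N.
  have : size (map_poly phi mp) = size mp by rewrite size_map_poly.
  have q0 : q != 0 by apply: contraNneq qx => ->; rewrite root0.
  rewrite qE size_mul ?polyXsubC_eq0 // size_XsubC addn2 /= => szq.
  by apply/eqP => q1; move: sz2; rewrite -szq q1.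
have yroot : root (map_poly phi mp) y by rewrite qE rootM qy.
have phiE z : phi z = iota (val z) by [].
have [s' [? ? s'x]] := adjoin_emb_root phiE mpP yroot.
exists s'; split=> //; rewrite s'x.
by apply: contraNneq qx => <-.
Qed.
End Adjoin.

(** * Generated subfields and number fields *)

Section Generated.
Variable R : realType.
Implicit Types (S K L : R -> Prop).

Lemma gen_field_subfield S : is_subfield (gen_field S).
Proof.
split=> [K hK _|K hK _|x y Sx Sy|x Sx x0 K hK SK].
- exact: subfield0.
- exact: subfield1.
- split=> K hK SK; have := Sx K hK SK; have := Sy K hK SK => Ky Kx.
  + exact: subfieldD.
  + exact: subfieldN.
  + exact: subfieldM.
- by apply: (subfieldV hK); exact: Sx.
Qed.

Lemma gen_field_incl S x : S x -> gen_field S x.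
Proof. by move=> Sx K _; exact. Qed.

Lemma gen_field_min S K : is_subfield K -> (forall x, S x -> K x) ->
  forall x, gen_field S x -> K x.
Proof. by move=> hK SK x; exact. Qed.

(* The [d + 1] powers [1, x, .., x ^+ d] are linearly dependent over [rat]. *)
Lemma number_field_algebraic K x : is_subfield K -> is_number_field K -> K x ->
  algebraicOver (ratr : rat -> R) x.
Proof.
move=> hK [d [b [Kb sp]]] Kx.
have /choice[q qE] : forall i : 'I_d.+1, exists q : 'I_d -> rat,
    x ^+ i = \sum_(j < d) ratr (q j) * b j.
  by move=> i; apply: sp; exact: subfieldX.
pose A : 'M[rat]_(d.+1, d) := \matrix_(i, j) q i j.
have kA : kermx A != 0.
  rewrite kermx_eq0 /row_free neq_ltn.
  by rewrite (leq_ltn_trans (rank_leq_col A)).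
have [u uA u0] : exists2 u : 'rV_d.+1, u *m A = 0 & u != 0.
  by have /rowV0Pn[u uk u0] := kA; exists u => //; exact/sub_kermxP.
exists (rVpoly u); first by apply: contra_neq u0 => E; rewrite -[u]rVpolyK E linear0.
rewrite /root (@horner_coef_wide _ d.+1); last first.
  by rewrite size_map_poly size_poly.
rewrite (eq_bigr (fun i : 'I_d.+1 =>
    \sum_(j < d) ratr (u 0 i * A i j) * b j)) => [|i _]; last first.
  rewrite qE coef_map coef_rVpoly_ord mulr_sumr; apply: eq_bigr => j _.
  by rewrite mxE mulrA -rmorphM.
rewrite exchange_big /= big1 // => j _; rewrite -mulr_suml -rmorph_sum /=.
have := congr1 (fun B : 'rV_d => B 0 j) uA; rewrite !mxE => ->.
by rewrite rmorph0 mul0r.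
Qed.

Lemma number_field_span K (J : finType) (b : J -> R) : (forall j, K (b j)) ->
  (forall x, K x -> exists q : J -> rat, x = \sum_j ratr (q j) * b j) ->
  is_number_field K.
Proof.
move=> Kb sp; exists #|J|, (b \o enum_val); split=> [i|x /sp[q ->]].
  exact: Kb.
exists (q \o enum_val); rewrite (reindex (@enum_val J predT)) //.
by apply: onW_bij; exact: enum_val_bij.
Qed.

(** Reduction modulo the minimal polynomial bounds the exponents, so the finitely many products
    [x ^+ i * b j] span. *)
Lemma number_field_adjoin L (hL : is_subfield L) x : is_number_field L ->
  algebraicOver (ratr : rat -> R) x -> is_number_field (adjoin hL x).
Proof.
move=> [d [b [Lb sp]]] xalg.
have [mp [mp0 mpP]] := minimal_poly (algebraicOver_subfield hL xalg).
have hA := adjoin_subfield hL xalg.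
apply: (@number_field_span _ ('I_(size mp) * 'I_d)%type
  (fun ij => x ^+ ij.1 * b ij.2)) => [[i j]|_ [p ->]] /=.
  apply: (subfieldM hA); first exact/(subfieldX hA)/adjoin_gen.
  exact/adjoin_base.
have -> : (map_poly val p).[x] = (map_poly val (p %% mp)).[x].
  apply/eqP; rewrite -subr_eq0 -hornerN -hornerD -rmorphN -rmorphD /=.
  by rewrite -/(root _ x) mpP {1}(divp_eq p mp) addrK dvdp_mull.
have /choice[q qE] : forall i : 'I_(size mp), exists q : 'I_d -> rat,
    val (p %% mp)`_i = \sum_(j < d) ratr (q j) * b j.
  by move=> i; apply: sp; exact: subfield_typeP.
exists (fun ij => q ij.1 ij.2).
rewrite (@horner_coef_wide _ (size mp)); last first.
  by rewrite size_map_poly ltnW // ltn_modp.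
rewrite -(pair_bigA _ (fun i j => ratr (q i j) * (x ^+ i * b j))) /=.
apply: eq_bigr => i _; rewrite coef_map; have /= -> := qE i.
rewrite mulr_suml; apply: eq_bigr => j _.
by rewrite mulrAC mulrA.
Qed.

(** Iterates [adjoin]. The result is known only through its properties: it is the least subfield
    with these elements, it stays a number field, and embeddings into a closed field extend to
    it. *)
Lemma adjoin_seq L (hL : is_subfield L) (xs : seq R) :
  (forall x, x \in xs -> algebraicOver (ratr : rat -> R) x) ->
  exists L', [/\ is_subfield L',
    (forall x, L x \/ x \in xs -> L' x),
    (forall K, is_subfield K -> (forall x, L x \/ x \in xs -> K x) ->
       forall x, L' x -> K x),
    (is_number_field L -> is_number_field L') &
    forall (C : closedFieldType) (s : R -> C), field_emb L s ->
      exists s' : R -> C, field_emb L' s' /\ forall z, L z -> s' z = s z].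
Proof.
elim: xs L hL => [|x xs IH] L hL xsalg.
  exists L; split=> // [x []//|K hK LK x Lx|C s hs].
    by apply: LK; left.
  by exists s.
have xalg : algebraicOver (ratr : rat -> R) x.
  by apply: xsalg; rewrite inE eqxx.
have [z zxs|L' [hL' sub' min' nf' emb']] := IH _ (adjoin_subfield hL xalg).
  by apply: xsalg; rewrite inE zxs orbT.
exists L'; split=> // [z|K hK LK z L'z|nfL|C s hs].
- case=> [Lz|]; first by apply: sub'; left; exact: adjoin_base.
  rewrite inE => /orP[/eqP ->|zxs]; apply: sub'; [left|by right].
  exact: adjoin_gen.
- apply: (min' K) => // y [|yxs]; last first.
    by apply: LK; right; rewrite inE yxs orbT.
  apply: adjoin_min => // [t Lt|]; apply: LK; first by left.
  by right; rewrite inE eqxx.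
- exact/nf'/number_field_adjoin.
- have [s1 [hs1 s1E]] := adjoin_emb hL xalg hs.
  have [s2 [hs2 s2E]] := emb' C s1 hs1.
  exists s2; split=> // z Lz; rewrite s2E ?s1E //.
  exact: adjoin_base.
Qed.

Lemma rat_subfield : is_subfield (fun x : R => exists q : rat, x = ratr q).
Proof.
split.
- by exists 0; rewrite rmorph0.
- by exists 1; rewrite rmorph1.
- move=> _ _ [p ->] [q ->]; split.
  + by exists (p + q); rewrite rmorphD.
  + by exists (- p); rewrite rmorphN.
  + by exists (p * q); rewrite rmorphM.
- by move=> _ [p ->] _; exists p^-1; rewrite fmorphV.
Qed.

Lemma rat_number_field :
  is_number_field (fun x : R => exists q : rat, x = ratr q).
Proof.
exists 1%N, (fun=> 1); split=> [_|_ [q ->]].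
  by exists 1; rewrite rmorph1.
by exists (fun=> q); rewrite big_ord1 mulr1.
Qed.

(** By minimality on both sides, the generated field is the one obtained from the rationals by
    adjoining [xs]. *)
Lemma gen_field_number_field S (xs : seq R) :
  (forall x, S x <-> x \in xs) ->
  (forall x, S x -> algebraicOver (ratr : rat -> R) x) ->
  is_number_field (gen_field S).
Proof.
move=> Sxs Salg.
have [z zxs|L [hL sub min nf _]] := adjoin_seq rat_subfield (xs := xs).
  exact/Salg/Sxs.
suff -> : gen_field S = L by apply: nf; exact: rat_number_field.
apply/funext => x; apply/propext; split.
  by apply: gen_field_min => // y /Sxs yxs; apply: sub; right.
apply: min; first exact: gen_field_subfield.
move=> y [[q ->]|/Sxs Sy]; last exact: gen_field_incl.
exact: subfield_rat (gen_field_subfield S) q.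
Qed.

Lemma algebraic_sqrt (x : R) : algebraicOver (ratr : rat -> R) (x ^+ 2) ->
  algebraicOver (ratr : rat -> R) x.
Proof.
move=> [p p0 px]; exists (p \Po 'X^2).
  by rewrite comp_poly_eq0 // size_polyXn.
by rewrite map_comp_poly map_polyXn /root horner_comp hornerXn.
Qed.
End Generated.

(** * Rescaling a symmetric matrix along walks in its graph *)

Section Switching.
Variables (R : realType) (T : finType) (g : T -> T -> R).
Hypothesis gC : forall i j, g i j = g j i.

Fixpoint walk_prod (x : T) (p : seq T) : R :=
  if p is y :: p' then g x y * walk_prod y p' else 1.

Lemma walk_prod_cat x p q :
  walk_prod x (p ++ q) = walk_prod x p * walk_prod (last x p) q.
Proof. by elim: p x => [|y p IH] x /=; rewrite ?mul1r // IH mulrA. Qed.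

Lemma walk_prod_rev x p :
  walk_prod (last x p) (rev (belast x p)) = walk_prod x p.
Proof.
elim: p x => [|y p IH] x //=.
rewrite rev_cons -cats1 walk_prod_cat IH /=.
have -> : last (last y p) (rev (belast y p)) = y.
  by case: p {IH} => [|z p] //=; rewrite rev_cons last_rcons.
by rewrite mulr1 mulrC gC.
Qed.

Lemma walk_prod_closed x p : walk_prod x (rcons p x) = cyc_prod g (x :: p).
Proof.
(* The closing vertex [z] is separated from the starting vertex, which changes during the
   induction. *)
rewrite /cyc_prod rot1_cons; move: {2 4}x => z.
elim: p x => [|y p IH] x /=; rewrite big_cons ?big_nil //=.
by rewrite IH.
Qed.

Lemma walk_prod_neq0 x p : path [rel i j | g i j != 0] x p ->
  walk_prod x p != 0.
Proof.
elim: p x => [|y p IH] x /=; first by rewrite oner_eq0.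
by case/andP => gxy yp; rewrite mulf_neq0 ?IH.
Qed.

(* [d i] is the product of the entries along a path from the root of the
   component of [i] to [i]; then [d i * g i j * d j] is the product along a
   closed walk, by symmetry. *)
Lemma switching (F K : R -> Prop) : is_subfield F -> is_subfield K ->
  (forall s, s != [::] -> F (cyc_prod g s)) -> (forall i j, K (g i j)) ->
  exists d : T -> R, [/\ forall i, d i != 0, forall i, K (d i) &
    forall i j, F (d i * g i j * d j)].
Proof.
move=> hF hK Fcyc Kg; pose r : rel T := [rel i j | g i j != 0].
have rC : connect_sym r by apply: sym_connect_sym => i j; rewrite /r /= gC.
have /choice[p pP] : forall i, exists p,
    path r (fingraph.root r i) p /\ i = last (fingraph.root r i) p.
  by move=> i; have := connect_root r i; rewrite rC => /connectP[p ? ?]; exists p.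
exists (fun i => walk_prod (fingraph.root r i) (p i)); split=> [i|i|i j].
- by apply: walk_prod_neq0; case: (pP i).
- elim: (p i) (fingraph.root r i) => [|y q IH] x /=; first exact: (subfield1 hK).
  exact: (subfieldM hK).
have [->|gij] := eqVneq (g i j) 0.
  by rewrite mulr0 mul0r; exact: (subfield0 hF).
(* A nonzero entry joins [i] and [j], so both paths start at the same root. *)
have rij : fingraph.root r j = fingraph.root r i.
  by apply/esym/eqP; rewrite root_connect //; exact: connect1.
have [_ iE] := pP i; have [_ jE] := pP j; rewrite rij in jE *.
set x := fingraph.root r i in iE jE *.
have -> : walk_prod x (p i) * g i j * walk_prod x (p j) =
    walk_prod x (p i ++ j :: rev (belast x (p j))).
  have E := walk_prod_rev x (p j); rewrite -jE in E.
  by rewrite walk_prod_cat /= -iE E mulrA.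
have : last x (p i ++ j :: rev (belast x (p j))) = x.
  rewrite last_cat /= ; case: (p j) jE => [|z q] //= _.
  by rewrite rev_cons last_rcons.
have : p i ++ j :: rev (belast x (p j)) != [::] by case: (p i).
(* The walk is nonempty and returns to its start, so splitting off its last vertex exhibits a cyclic
   product. *)
case/lastP: (_ ++ _) => // q y _; rewrite last_rcons => ->.
by rewrite walk_prod_closed; exact: Fcyc.
Qed.

End Switching.

(** * The Lorentz form and faces *)

Section Lorentz.
Variables (R : realType) (n : nat).
Implicit Types x y u v : 'rV[R]_n.+1.

Lemma lor_split x y :
  lor x y = \sum_(i | i != ord_max) x 0 i * y 0 i - x 0 ord_max * y 0 ord_max.
Proof.
rewrite /lor (bigD1 ord_max) //= eqxx addrC; congr (_ - _).
by apply: eq_bigr => i /negPf ->.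
Qed.

Lemma lorC x y : lor x y = lor y x.
Proof. by apply: eq_bigr => i _; rewrite mulrC. Qed.

Lemma lorDl u v x : lor (u + v) x = lor u x + lor v x.
Proof.
rewrite /lor -big_split; apply: eq_bigr => i _ /=; rewrite !mxE.
by case: ifP => _; ring.
Qed.

Lemma lorZl a u x : lor (a *: u) x = a * lor u x.
Proof.
rewrite /lor mulr_sumr; apply: eq_bigr => i _; rewrite !mxE.
by case: ifP => _; ring.
Qed.

Lemma lorDr x u v : lor x (u + v) = lor x u + lor x v.
Proof. by rewrite lorC lorDl !(lorC _ x). Qed.

Lemma lorZr a x u : lor x (a *: u) = a * lor x u.
Proof. by rewrite lorC lorZl lorC. Qed.

Lemma lorNl u x : lor (- u) x = - lor u x.
Proof. by rewrite -scaleN1r lorZl mulN1r. Qed.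

Lemma lorNr x u : lor x (- u) = - lor x u.
Proof. by rewrite lorC lorNl lorC. Qed.

Lemma lor0l x : lor 0 x = 0.
Proof. by rewrite -[X in lor X _](scale0r x) lorZl mul0r. Qed.

Lemma lor_suml (J : Type) (r : seq J) (P : pred J) (F : J -> 'rV[R]_n.+1) x :
  lor (\sum_(j <- r | P j) F j) x = \sum_(j <- r | P j) lor (F j) x.
Proof.
elim: r => [|j r IH]; first by rewrite !big_nil lor0l.
by rewrite !big_cons; case: (P j); rewrite ?lorDl IH.
Qed.

Lemma lor_sumr (J : Type) (r : seq J) (P : pred J) (F : J -> 'rV[R]_n.+1) x :
  lor x (\sum_(j <- r | P j) F j) = \sum_(j <- r | P j) lor x (F j).
Proof. by rewrite lorC lor_suml; apply: eq_bigr => j _; rewrite lorC. Qed.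

(** Some column of the cokernel of [A] does not kill [h]; flipping the sign of its last coordinate
    turns the Euclidean pairing into the Lorentz one. *)
Lemma lor_separation p (A : 'M[R]_(p, n.+1)) (h : 'rV[R]_n.+1) :
  ~~ (h <= A)%MS -> exists u, (forall i, lor (row i A) u = 0) /\ lor h u != 0.
Proof.
rewrite submxE => /matrix0Pn[i [j hj]].
pose u : 'rV[R]_n.+1 :=
  \row_l (if l == ord_max then - cokermx A l j else cokermx A l j).
have uE x : lor x u = (x *m cokermx A) 0 j.
  rewrite mxE; apply: eq_bigr => l _; rewrite [u 0 l]mxE.
  by case: (eqVneq l ord_max) => _; rewrite ?mulrN ?opprK.
exists u; split=> [l|]; last by rewrite uE -(ord1 i).
by rewrite uE -row_mul mulmx_coker row0 mxE.
Qed.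

(** A reversed Cauchy-Schwarz inequality: sum the squares of [b * x 0 i - a * y 0 i] over the
    spatial coordinates and use that the spatial norms are [a ^+ 2 - 1] and [b ^+ 2 - 1]. *)
Lemma lor_hyp_lt0 x y : Hyp x -> Hyp y -> lor x y < 0.
Proof.
move=> [xx x0] [yy y0]; move: xx yy; rewrite !lor_split.
set a := x 0 ord_max in x0 *; set b := y 0 ord_max in y0 *.
set X := \sum_(i | _) _ * _; set Y := \sum_(i | _) _ * _.
set Z := \sum_(i | _) _ * _ => xx yy.
have le : 2 * (a * b) * Z <= b ^+ 2 * X + a ^+ 2 * Y.
  rewrite !mulr_sumr -big_split /=; apply: ler_sum => i _.
  rewrite -subr_ge0; set s := _ - _.
  have -> : s = (b * x 0 i - a * y 0 i) ^+ 2 by rewrite /s; ring.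
  exact: sqr_ge0.
have ab : 0 < a * b by rewrite mulr_gt0.
have a2 : 0 < a ^+ 2 by rewrite exprn_gt0.
have b2 : 0 < b ^+ 2 by rewrite exprn_gt0.
rewrite subr_lt0 -(ltr_pM2l ab).
have XE : X = a * a - 1 by lra.
have YE : Y = b * b - 1 by lra.
move: le; rewrite XE YE => le; nra.
Qed.

Lemma hyp_normalize y : lor y y < 0 -> 0 < y 0 ord_max ->
  exists2 c, 0 < c & Hyp (c *: y).
Proof.
move=> yy y0; exists (Num.sqrt (- lor y y))^-1.
  by rewrite invr_gt0 sqrtr_gt0 oppr_gt0.
split; last by rewrite mxE mulr_gt0 // invr_gt0 sqrtr_gt0 oppr_gt0.
rewrite lorZl lorZr mulrA -invfM -expr2 sqr_sqrtr; last by rewrite oppr_ge0 ltW.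
by rewrite invrN mulNr mulVf // lt_eqF.
Qed.

End Lorentz.

(** Finitely many strict inequalities survive a common small step; [1 + S] exceeds every ratio of
    [b] to [a] in absolute value. *)
Lemma small_perturbation (R : realType) (T : finType) (a b : T -> R) :
  (forall i, 0 < a i) -> exists2 eps, 0 < eps &
    forall i t, 0 <= t <= eps -> t * `|b i| < a i.
Proof.
move=> a0; pose S := \sum_i `|b i| / a i.
have S0 : 0 <= S by apply: sumr_ge0 => i _; rewrite divr_ge0 // ltW.
have D0 : 0 < 1 + S by rewrite ltr_wpDr.
exists (1 + S)^-1; first by rewrite invr_gt0.
move=> i t /andP[t0 tle].
have le : `|b i| / a i <= S.
  rewrite /S (bigD1 i) //= lerDl; apply: sumr_ge0 => j _.
  by rewrite divr_ge0 // ltW.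
apply: (@le_lt_trans _ _ ((1 + S)^-1 * `|b i|)); first by rewrite ler_wpM2r.
rewrite mulrC ltr_pdivrMr // -ltr_pdivrMl // mulrC.
by apply: (le_lt_trans le); rewrite ltrDr.
Qed.

(** * The linear span of a face and the projection onto it *)

Section FaceProjection.
Variables (R : realType) (n m k : nat).
Variables (e : 'I_m -> 'rV[R]_n.+1) (I : {set 'I_m}) (M : 'M[R]_(k.+1, n.+1)).
Hypothesis face_dim : span_dim (face_set e I) k.+1.
Hypothesis chart : chart_of M (face_set e I).

(** Every index of [I] qualifies, but further hyperplanes may contain the face as well. *)
Definition face_hyperplane (b : 'I_m) : Prop :=
  forall x, face_set e I x -> lor x (e b) = 0.

(** By a rank count the points of the face span the whole image of [M], so a linear form vanishing
    on the face vanishes there. *)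
Lemma chart_orthogonal u b : face_hyperplane b -> lor (u *m M) (e b) = 0.
Proof.
move=> hb; have [X [FX rX sX]] := face_dim; have [_ _ FM] := chart.
have XM : (X <= M)%MS by apply/row_subP => i; exact: FM.
have MX : (M <= X)%MS.
  have [] := mxrank_leqif_sup XM => _ <-.
  by rewrite eqn_leq (mxrankS XM) rX rank_leq_row.
have /submxP[D ->] : (u *m M <= X)%MS by rewrite mulmx_sub.
rewrite mulmx_sum_row lor_suml big1 // => i _.
by rewrite lorZl hb ?mulr0.
Qed.

(* A relative interior point of the face stays in the cone over the face when
   moved slightly along the common orthogonal of its hyperplanes. *)
Lemma face_span u : (forall b, face_hyperplane b -> lor u (e b) = 0) ->
  (u <= M)%MS.
Proof.
move=> uperp; have [X [FX rX sX]] := face_dim; have [_ _ FM] := chart.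
pose o := row ord0 X.
(* For each hyperplane not containing the face, choose a point of the face off it; the sum [x0] is
   then strictly inside all of these. *)
have /choice[pt ptP] : forall b, exists x, face_set e I x /\
    (~ face_hyperplane b -> lor x (e b) < 0).
  move=> b; have [hb|nhb] := pselect (face_hyperplane b).
    by exists o; split; [exact: FX|].
  have [x /not_implyP[Fx xb]] : exists x, ~ (face_set e I x -> lor x (e b) = 0).
    exact/existsNP.
  exists x; split=> // _; rewrite lt_neqAle; apply/andP; split; first exact/eqP.
  by case: Fx => -[_ Px] _.
pose x0 := o + \sum_b pt b.
have x0M : (x0 <= M)%MS.
  apply: addmx_sub; first exact/FM/FX.
  by apply: summx_sub => b _; apply: FM; case: (ptP b).
have face_le x b : face_set e I x -> lor x (e b) <= 0 by case=> -[_ h] _.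
have faceH x : face_set e I x -> Hyp x by case=> -[h _] _.
have Fpt b : face_set e I (pt b) by case: (ptP b).
have Fo : face_set e I o by exact: FX.
have x0e b : ~ face_hyperplane b -> 0 < - lor x0 (e b).
  move=> nhb; rewrite oppr_gt0 lorDl lor_suml.
  apply: (le_lt_trans (y := lor (pt b) (e b))); last by case: (ptP b) => _; apply.
  rewrite (bigD1 b) //= addrCA -lerBrDl subrr.
  by rewrite -[leRHS]addr0 lerD ?face_le // sumr_le0 // => j _; exact: face_le.
have x0x0 : 0 < - lor x0 x0.
  rewrite oppr_gt0; have lt y : face_set e I y -> lor x0 y < 0.
    move=> Fy; rewrite lorDl lor_suml ltr_nwDl ?lor_hyp_lt0 //; try exact: faceH.
    by apply: sumr_le0 => j _; apply/ltW/lor_hyp_lt0; exact: faceH.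
  rewrite {2}/x0 lorDr lor_sumr ltr_nwDl ?lt //.
  by apply: sumr_le0 => j _; exact/ltW/lt.
have x0l : 0 < x0 0 ord_max.
  rewrite !mxE summxE ltr_pwDl //; first by have [_] := faceH _ Fo; rewrite mxE.
  by apply: sumr_ge0 => j _; have [_ /ltW] := faceH _ (Fpt j).
have x0hb b : face_hyperplane b -> lor x0 (e b) = 0.
  by move=> hb; rewrite lorDl lor_suml hb // big1 ?addr0 // => j _; exact: hb.
clearbody x0.
(* Three kinds of strict inequality must survive: negative norm, positive last coordinate, and
   strict sides of hyperplanes. The 1 is a placeholder for hyperplanes containing the face. *)
pose a (b : option (option 'I_m)) := match b with
  | None => - lor x0 x0 | Some None => x0 0 ord_max
  | Some (Some b) => if `[< face_hyperplane b >] then 1 else - lor x0 (e b) end.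
pose c (b : option (option 'I_m)) := match b with
  | None => 2 * `|lor x0 u| + `|lor u u| | Some None => u 0 ord_max
  | Some (Some b) => lor u (e b) end.
have [|eps eps0 epsP] := @small_perturbation R _ a c.
  move=> [[b|]|] //=; case: asboolP => //; exact: x0e.
pose t := Num.min eps 1.
have t0 : 0 < t by rewrite lt_min eps0 ltr01.
have t1 : t <= 1 by rewrite ge_min lexx orbT.
have tP b : t * `|c b| < a b by apply: epsP; rewrite (ltW t0) ge_min lexx.
pose y := x0 + t *: u.
have yy : lor y y < 0.
  have := tP None; rewrite /= ger0_norm ?addr_ge0 ?mulr_ge0 // => lt.
  rewrite /y !lorDl !lorDr !lorZl !lorZr (lorC u x0).
  have h1 := ler_norm (lor x0 u); have h2 := ler_norm (lor u u).
  have h3 : 0 <= `|lor u u| := normr_ge0 _.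
  have h4 : 0 <= `|lor x0 u| := normr_ge0 _.
  have h5 : t * (t * lor u u) <= t * `|lor u u|.
    rewrite ler_pM2l //; apply: (@le_trans _ _ (t * `|lor u u|)).
      by rewrite ler_pM2l.
    by rewrite ler_piMl.
  have h6 : t * lor x0 u <= t * `|lor x0 u| by rewrite ler_pM2l.
  move: lt; rewrite mulrDr mulrCA => lt; lra.
have yl : 0 < y 0 ord_max.
  have := tP (Some None); rewrite /= !mxE => lt.
  have := ler_norm (- u 0 ord_max); rewrite normrN -(ler_pM2l t0) => le.
  by move: lt le; rewrite mulrN; lra.
have [r r0 Hy] := hyp_normalize yy yl.
have ye b : lor y (e b) <= 0.
  rewrite lorDl lorZl.
  have [hb|nhb] := pselect (face_hyperplane b).
    by rewrite uperp // x0hb // mulr0 addr0.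
  have := tP (Some (Some b)); rewrite /= asboolF // => lt.
  have := ler_norm (lor u (e b)); rewrite -(ler_pM2l t0) => le.
  by move: lt le; lra.
have Fy : face_set e I (r *: y).
  split; first by split=> // b; rewrite lorZl pmulr_rle0.
  move=> b bI; rewrite lorZl; have hb : face_hyperplane b by move=> z [_]; apply.
  by rewrite lorDl lorZl uperp // x0hb // mulr0 addr0 mulr0.
have yM : (y <= M)%MS.
  by rewrite -[y](scalerK (lt0r_neq0 r0)) scalemx_sub // FM.
have -> : u = t^-1 *: (y - x0).
  by rewrite /y addrAC subrr add0r scalerK // lt0r_neq0.
by rewrite scalemx_sub // addmx_sub // -scaleN1r scalemx_sub.
Qed.

(* [w] is the orthogonal projection of [e j] to the span of the face; since
   that span contains the common orthogonal of the [e b] vanishing on the face,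
   the difference [e j - w] is a combination of these [e b]. *)
Lemma face_normal_decomposition j (f : 'rV[R]_k.+1) : face_normal M (e j) f ->
  exists c (alpha : 'I_m -> R) w, [/\ 0 < c, w = c^-1 *: (f *m M),
    e j = w + \sum_(b | `[< face_hyperplane b >]) alpha b *: e b &
    forall b, face_hyperplane b -> lor w (e b) = 0].
Proof.
move=> [_ [c [c0 fP]]]; have [iso _ _] := chart.
set w := c^-1 *: (f *m M).
pose A : 'M[R]_(m, n.+1) :=
  \matrix_b (if `[< face_hyperplane b >] then e b else 0).
have rowA b : row b A = if `[< face_hyperplane b >] then e b else 0.
  by rewrite rowK.
have wM u : lor w (u *m M) = lor (e j) (u *m M).
  by rewrite /w lorZl iso fP mulKf // lt0r_neq0.
(* Otherwise some [u] orthogonal to these [e b] separates [e j - w] from them; but [u] lies in the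
   image of [M], where [e j] and [w] pair equally. *)
have /submxP[D hD] : (e j - w <= A)%MS.
  apply: contraT => /lor_separation[u [uA]].
  have /face_span/submxP[v ->] : forall b, face_hyperplane b -> lor u (e b) = 0.
    by move=> b hb; have := uA b; rewrite rowA asboolT // lorC.
  by rewrite lorDl lorNl wM subrr eqxx.
exists c, (D 0), w; split=> // [|b hb].
  rewrite -[LHS](subrK w) addrC hD mulmx_sum_row [in RHS]big_mkcond /=.
  congr (_ + _); apply: eq_bigr => b _; rewrite rowA.
  by case: asboolP => _ //; rewrite scaler0.
by rewrite lorZl chart_orthogonal ?mulr0.
Qed.

End FaceProjection.

(** * Infinite volume *)

Section InfiniteVolume.
Variable R : realType.

Lemma iter_int_ge0 d (F : seq R -> \bar R) : (forall s, 0%E <= F s)%E ->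
  (0 <= iter_int d F)%E.
Proof.
elim: d F => [|d IH] F F0 /=; first exact: F0.
by apply: integral_ge0 => t _; exact: IH.
Qed.

Import HBNNSimple.

(* Monotonicity from the definition as a supremum over simple functions: the
   inner iterated integrals are not known to be measurable. *)
Lemma ge0_le_integralT (F G : R -> \bar R) : (forall t, 0 <= F t)%E ->
  (forall t, F t <= G t)%E ->
  (\int[@lebesgue_measure R]_(t in [set: R]) F t <=
   \int[@lebesgue_measure R]_(t in [set: R]) G t)%E.
Proof.
move=> F0 FG; rewrite !ge0_integralTE //; last first.
  by move=> t; exact: le_trans (F0 t) (FG t).
apply: le_ereal_sup => _ [h hF <-]; exists h => // t.
exact: le_trans (hF t) (FG t).
Qed.

(** Each coordinate is integrated only over the half-interval from its value in [w] to that value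
    plus [delta], whence a factor [delta] per dimension. *)
Lemma iter_int_box d (F : seq R -> \bar R) (w : seq R) (delta a : R) :
  size w = d -> 0 < delta -> 0 <= a -> (forall s, 0 <= F s)%E ->
  (forall s, size s = d ->
     (forall i, (i < d)%N -> `|nth 0 s i - nth 0 w i| <= delta) ->
     (a%:E <= F s)%E) ->
  ((a * delta ^+ d)%:E <= iter_int d F)%E.
Proof.
elim: d F w => [|d IH] F [|w0 w] // szw delta0 a0 F0 Fa /=.
  by rewrite expr0 mulr1; exact: Fa.
case: szw => szw.
pose D : set R := `[w0, w0 + delta]%classic.
apply: (@le_trans _ _
  (\int[@lebesgue_measure R]_(t in D) (cst (a * delta ^+ d)%:E) t)%E).
  rewrite integral_cst //; last exact: measurable_itv.
  have mD : lebesgue_measure D = delta%:E.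
    rewrite /D lebesgue_measure_itv /= lte_fin ltrDl delta0 -EFinD.
    by rewrite addrAC subrr add0r.
  set mu := (X in (_ * X)%E); have -> : mu = delta%:E by exact: etrans mD.
  by rewrite -EFinM lee_fin exprSr mulrA.
rewrite integral_mkcond; apply: ge0_le_integralT => t.
  by apply: erestrict_ge0 => *; rewrite lee_fin mulr_ge0 // exprn_ge0 // ltW.
rewrite patchE; case: ifPn => [|_]; last exact: iter_int_ge0.
rewrite inE /D /= in_itv /= => /andP[t1 t2].
apply: (IH (fun s => F (t :: s)) w) => // s szs sw; apply: Fa => /=.
  by rewrite szs.
case=> [_|i]; last by rewrite ltnS; exact: sw.
by rewrite /= ler_norml; apply/andP; split; lra.
Qed.

Lemma sum_sqr_chart k (s : seq R) : size s = k ->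
  \sum_(t <- s) t ^+ 2 = \sum_(i < k.+1 | i != ord_max) s`_i ^+ 2.
Proof.
move=> szs; rewrite (big_nth 0) szs big_mkord [RHS]big_mkcond big_ord_recr /=.
rewrite eqxx addr0; apply: eq_bigr => i _.
by rewrite -val_eqE /= ltn_eqF.
Qed.

Lemma chart_hyp k (s : seq R) : size s = k -> Hyp (chart_pt s : 'rV[R]_k.+1).
Proof.
move=> szs; have S0 : 0 <= \sum_(t <- s) t ^+ 2.
  by apply: sumr_ge0 => t _; exact: sqr_ge0.
split; last by rewrite mxE eqxx sqrtr_gt0 ltr_wpDr.
rewrite lor_split mxE eqxx -expr2 sqr_sqrtr ?addr_ge0 //.
rewrite (eq_bigr (fun i : 'I_k.+1 => s`_i ^+ 2)) => [|i /negPf ni]; last first.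
  by rewrite mxE ni expr2.
by rewrite -sum_sqr_chart // opprD addrCA subrr addr0.
Qed.

Lemma lor_bound n (x y : 'rV[R]_n.+1) c : (forall i, `|x 0 i| <= c) ->
  lor x y <= c * \sum_i `|y 0 i|.
Proof.
move=> xc; rewrite /lor mulr_sumr; apply: ler_sum => i _.
apply: (@le_trans _ _ (`|x 0 i| * `|y 0 i|)).
  by rewrite -normrM; case: ifP => _; rewrite ?ler_norm // -normrN ler_norm.
by rewrite ler_wpM2r.
Qed.

(* Far from the origin, the hyperboloid approaches the light cone, so it
   contains a large box around the spatial part of [lambda *: w]. *)
Lemma lightlike_boxes k (T : finType) (f : T -> 'rV[R]_k.+1) w :
  lor w w = 0 -> 0 <= w 0 ord_max -> (forall j, lor w (f j) < 0) ->
  exists delta B lambda0, [/\ 0 < delta, 0 < B, 1 <= lambda0 &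
    forall lambda (s : seq R), lambda0 <= lambda -> size s = k ->
    (forall i : 'I_k.+1, i != ord_max ->
      `|s`_i - lambda * w 0 i| <= lambda * delta) ->
    polyset f (chart_pt s) /\
    Num.sqrt (1 + \sum_(t <- s) t ^+ 2) <= lambda * B].
Proof.
move=> ww w0 wf.
(* Changing the coordinates of [w] by at most [rho] keeps it strictly inside every half-space. *)
have [|rho rho0 rhoP] := @small_perturbation R T (fun j => - lor w (f j))
    (fun j => \sum_i `|f j 0 i|).
  by move=> j; rewrite oppr_gt0.
(* Changing the spatial coordinates of [w] by at most [delta <= 1] changes their sum of squares by
   at most [delta * C], which the choice of [delta] keeps below [rho ^+ 2 / 2]. *)
pose C := \sum_(i < k.+1 | i != ord_max) (2 * `|w 0 i| + 1).
have C0 : 0 <= C by apply: sumr_ge0 => i _; rewrite addr_ge0 ?mulr_ge0.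
pose delta := Num.min 1 (Num.min rho (rho ^+ 2 / (2 * (C + 1)))).
have C1 : 0 < C + 1 by rewrite ltr_wpDl.
have rho2 : 0 < rho ^+ 2 by rewrite exprn_gt0.
have d0 : 0 < delta by rewrite !lt_min ltr01 rho0 divr_gt0 ?mulr_gt0.
have d1 : delta <= 1 by rewrite ge_min lexx.
have drho : delta <= rho by rewrite !ge_min lexx orbT.
have dC : delta * C <= rho ^+ 2 / 2.
  have le : delta <= rho ^+ 2 / (2 * (C + 1)) by rewrite !ge_min lexx !orbT.
  apply: (@le_trans _ _ (delta * (C + 1))); first by rewrite ler_pM2l // lerDl.
  rewrite -ler_pdivlMr //; apply: le_trans le _.
  by rewrite invfM mulrA.
exists delta, (w 0 ord_max + rho), (Num.max 1 (2 / rho)); split=> //.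
- by rewrite ltr_wpDl.
- by rewrite le_max lexx.
move=> lam s; rewrite ge_max => /andP[lam1 lamrho] szs sw.
have lam0 : 0 < lam by exact: lt_le_trans lam1.
set sg := Num.sqrt _.
have S0 : 0 <= \sum_(t <- s) t ^+ 2.
  by apply: sumr_ge0 => t _; exact: sqr_ge0.
have sg0 : 0 <= sg by exact: sqrtr_ge0.
have sg2 : sg ^+ 2 = 1 + \sum_(t <- s) t ^+ 2.
  by rewrite sqr_sqrtr // addr_ge0.
pose y : 'rV[R]_k.+1 := chart_pt s.
pose eta : 'rV[R]_k.+1 := lam^-1 *: y - w.
have yE : y = lam *: (w + eta).
  by rewrite /eta addrC subrK scalerA mulfV ?scale1r // lt0r_neq0.
have etaE (i : 'I_k.+1) : i != ord_max -> eta 0 i = lam^-1 * s`_i - w 0 i.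
  by move=> /negPf ni; rewrite !mxE ni.
have etad (i : 'I_k.+1) : i != ord_max -> `|eta 0 i| <= delta.
  move=> ni; rewrite etaE // -(ler_pM2l lam0) -{1}(gtr0_norm lam0) -normrM.
  by rewrite mulrBr mulVKf ?lt0r_neq0 // sw.
have etal : eta 0 ord_max = lam^-1 * sg - w 0 ord_max.
  by rewrite !mxE eqxx.
have wl2 : w 0 ord_max ^+ 2 = \sum_(i < k.+1 | i != ord_max) w 0 i ^+ 2.
  by move: ww; rewrite lor_split expr2 => /eqP; rewrite subr_eq0 => /eqP <-.
have sgl : (lam^-1 * sg) ^+ 2 = lam ^- 2 +
    \sum_(i < k.+1 | i != ord_max) (w 0 i + eta 0 i) ^+ 2.
  rewrite exprMn sg2 mulrDr mulr1 exprVn (sum_sqr_chart szs) mulr_sumr.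
  congr (_ + _); apply: eq_bigr => i ni.
  by rewrite etaE // addrCA subrr addr0 exprMn exprVn.
have close : `|(lam^-1 * sg) ^+ 2 - w 0 ord_max ^+ 2| <= rho ^+ 2.
  have -> : (lam^-1 * sg) ^+ 2 - w 0 ord_max ^+ 2 = lam ^- 2 +
      \sum_(i < k.+1 | i != ord_max) (2 * w 0 i * eta 0 i + eta 0 i ^+ 2).
    rewrite sgl wl2 -addrA -sumrB; congr (_ + _); apply: eq_bigr => i _; ring.
  have le1 : `|\sum_(i < k.+1 | i != ord_max)
      (2 * w 0 i * eta 0 i + eta 0 i ^+ 2)| <= delta * C.
    apply: (le_trans (ler_norm_sum _ _ _)); rewrite mulr_sumr.
    apply: ler_sum => i ni; apply: (le_trans (ler_normD _ _)).
    rewrite expr2 !normrM normr_nat mulrDr mulr1; apply: lerD.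
      by rewrite mulrC ler_wpM2r ?mulr_ge0 ?etad.
    apply: (@le_trans _ _ (1 * `|eta 0 i|)).
      by rewrite ler_wpM2r // (le_trans (etad i ni)).
    by rewrite mul1r etad.
  have le2 : `|lam ^- 2| <= rho ^+ 2 / 2.
    rewrite ger0_norm ?invr_ge0 ?exprn_ge0 ?(ltW lam0) //.
    have : lam^-1 <= rho / 2.
      by rewrite -[rho / 2]invrK lef_pV2 ?posrE ?invr_gt0 ?divr_gt0 // invfM invrK mulrC.
    rewrite -exprVn => le; apply: (@le_trans _ _ ((rho / 2) ^+ 2)).
      by rewrite ler_sqr // nnegrE ?invr_ge0 ?divr_ge0 // ltW.
    by rewrite exprMn ler_pM2l // expr2; lra.
  by apply: (le_trans (ler_normD _ _)); lra.
(* For nonnegative [A] and [Bw], the square of [A - Bw] is at most the absolute value of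
   [A ^+ 2 - Bw ^+ 2]. *)
have etalast : `|eta 0 ord_max| <= rho.
  rewrite etal -ler_sqr ?nnegrE ?(ltW rho0) //.
  rewrite real_normK ?num_real //; apply: le_trans close.
  have A0 : 0 <= lam^-1 * sg by rewrite mulr_ge0 // invr_ge0 ltW.
  set A := lam^-1 * sg in A0 *; set Bw := w 0 ord_max in w0 *.
  rewrite subr_sqr normrM -[_ ^+ 2]ger0_norm ?sqr_ge0 // normrX expr2.
  rewrite ler_wpM2l // ler_norml ger0_norm ?addr_ge0 //.
  by apply/andP; split; lra.
have etarho i : `|eta 0 i| <= rho.
  by have [->//|ni] := eqVneq i ord_max; rewrite (le_trans (etad i ni)).
split.
  split=> [|j]; first exact: chart_hyp.
  rewrite -/y yE lorZl lorDl pmulr_rle0 //.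
  have := rhoP j rho; rewrite (ltW rho0) lexx => /(_ isT).
  rewrite ger0_norm ?sumr_ge0 // => lt.
  have := lor_bound (f j) etarho; lra.
have -> : sg = lam * (w 0 ord_max + eta 0 ord_max).
  by rewrite etal addrCA subrr addr0 mulVKf // lt0r_neq0.
rewrite ler_pM2l // lerD2l; exact: le_trans (ler_norm _) etalast.
Qed.

(* If the Gram matrix were positive semidefinite, the time axis would not be
   in the span of the normals, so some [v] with last coordinate 1 would be
   orthogonal to all of them. Sliding an interior point along [v] reaches the
   light cone while staying in the interior of the cone over the polytope. *)
Lemma psd_not_finite_volume k (T : finType) (f : T -> 'rV[R]_k.+1) :
  (2 <= k)%N -> has_interior f -> psd (gram f) -> ~ finite_volume f.
Proof.
move=> k2 [x [[xx x0] xf]] psdf.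
pose eL : 'rV[R]_k.+1 := delta_mx 0 ord_max.
have eLE y : lor eL y = - y 0 ord_max.
  rewrite lor_split big1 ?sub0r ?mxE ?eqxx ?mul1r // => i /negPf ni.
  by rewrite mxE eqxx ni mul0r.
pose A : 'M[R]_(#|T|, k.+1) := \matrix_(i < #|T|) f (enum_val i).
(* If [eL] were a combination of the normals, its norm -1 would be a value of the semidefinite Gram
   form. *)
have /lor_separation[v0 [v0A]] : ~~ (eL <= A)%MS.
  apply/negP => /submxP[D eD].
  have := psdf (fun j => D 0 (enum_rank j)).
  have sumE (F : T -> 'rV[R]_k.+1) : \sum_(i < #|T|) F (enum_val i) = \sum_j F j.
    rewrite [RHS](reindex (@enum_val T predT)) //.
    by apply: onW_bij; exact: enum_val_bij.
  have eLs : eL = \sum_j D 0 (enum_rank j) *: f j.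
    rewrite eD mulmx_sum_row -sumE; apply: eq_bigr => i _.
    by rewrite enum_valK rowK.
  have -> : \sum_i \sum_j D 0 (enum_rank i) * gram f i j * D 0 (enum_rank j)
      = lor eL eL.
    rewrite {1}eLs lor_suml; apply: eq_bigr => i _.
    rewrite eLs lor_sumr; apply: eq_bigr => j _.
    by rewrite lorZl lorZr /gram; ring.
  by rewrite eLE mxE !eqxx oppr_ge0 leNgt ltr01.
rewrite eLE oppr_eq0 => v0l.
pose v := (v0 0 ord_max)^-1 *: v0.
have vl : v 0 ord_max = 1 by rewrite mxE mulVf.
have vf j : lor v (f j) = 0.
  by have := v0A (enum_rank j); rewrite rowK enum_rankK lorZl lorC => ->; rewrite mulr0.
clearbody v.
pose p : {poly R} := (-1)%:P - (2 * lor x v) *: 'X + lor v v *: 'X^2.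
have pE t : p.[t] = lor (x - t *: v) (x - t *: v).
  rewrite /p hornerD hornerD hornerN !hornerZ hornerC hornerX hornerXn.
  rewrite lorDl !lorDr !lorNl !lorNr !lorZl !lorZr xx (lorC v x).
  ring.
(* The norm [p] is -1 at 0 and nonnegative at [x 0 ord_max], where the last coordinate of
   [x - t *: v] vanishes. *)
have [|t /andP[t0 tx] /rootP pt] := @poly_ivt R p 0 (x 0 ord_max) (ltW x0).
  rewrite !pE scale0r subr0 xx lerN10 /= lor_split.
  have -> : (x - x 0 ord_max *: v) 0 ord_max = 0 by rewrite 2!mxE mxE vl mulr1 subrr.
  by rewrite mulr0 subr0; apply: sumr_ge0 => i _; rewrite -expr2 sqr_ge0.
pose w := x - t *: v.
have ww : lor w w = 0 by rewrite -pE.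
have wl : 0 <= w 0 ord_max by rewrite !mxE vl mulr1 subr_ge0.
have wf j : lor w (f j) < 0 by rewrite lorDl lorNl lorZl vf mulr0 subr0.
have [delta [B [lam0 [d0 B0 l1 box]]]] := lightlike_boxes ww wl wf.
rewrite /finite_volume /hvol.
set F := fun s : seq R => _.
have F0 s : (0 <= F s)%E.
  by rewrite /F; case: asboolP => _ //; rewrite lee_fin invr_ge0 sqrtr_ge0.
(* A box of side [lam * delta] carries density at least [(lam * B)^-1]; since [k >= 2], at least one
   factor [lam] remains. *)
have lower lam : lam0 <= lam ->
    ((lam * delta ^+ k / B)%:E <= iter_int k F)%E.
  move=> le; have lam1 : 1 <= lam by exact: le_trans le.
  have lamp : 0 < lam by exact: lt_le_trans lam1.
  pose w' := mkseq (fun i => lam * w 0 (inord i)) k.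
  have : (((lam * B)^-1 * (lam * delta) ^+ k)%:E <= iter_int k F)%E.
    apply: (@iter_int_box _ _ w') => //; first by rewrite size_mkseq.
    - by rewrite mulr_gt0.
    - by rewrite invr_ge0 mulr_ge0 // ltW.
    move=> s szs sw; have [|inP sq] := box lam s le szs.
      move=> i ni; have ik : (i < k)%N.
        by rewrite ltn_neqAle -ltnS ltn_ord andbT; move: ni; rewrite -val_eqE.
      by have := sw i ik; rewrite nth_mkseq // inord_val.
    rewrite /F asboolT // lee_fin lef_pV2 // posrE ?mulr_gt0 //.
    by rewrite sqrtr_gt0 ltr_wpDr // sumr_ge0 // => t' _; exact: sqr_ge0.
  apply: le_trans; rewrite lee_fin exprMn invfM.
  have -> : lam^-1 * B^-1 * (lam ^+ k * delta ^+ k) =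
      (lam^-1 * lam ^+ k) * delta ^+ k / B by ring.
  rewrite ler_pM2r ?invr_gt0 // ler_pM2r ?exprn_gt0 //.
  case: (k) k2 => [|[|k']] // _; rewrite exprS mulKf ?lt0r_neq0 //.
  by rewrite exprS ler_peMr ?exprn_ege1 // ltW.
have V0 : (0 <= iter_int k F)%E by exact: iter_int_ge0.
case: (iter_int k F) V0 lower => [V|//|//]; rewrite lee_fin => V0 lower _.
have dk : 0 < delta ^+ k / B by rewrite divr_gt0 // exprn_gt0.
(* This value of [lam] pushes the lower bound to at least [V + 1]. *)
have := lower (lam0 + (V + 1) / (delta ^+ k / B)).
have -> : lam0 <= lam0 + (V + 1) / (delta ^+ k / B).
  by rewrite lerDl divr_ge0 ?addr_ge0 // (ltW dk).
move=> /(_ isT); rewrite lee_fin -mulrA mulrDl divfK ?lt0r_neq0 //.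
have : 0 <= lam0 * (delta ^+ k / B) by rewrite mulr_ge0 ?ltW // (lt_le_trans ltr01).
lra.
Qed.

End InfiniteVolume.

(** * The Gram matrix of a face *)

Section ScaledGram.
Variables (R : realType) (n m : nat) (e : 'I_m -> 'rV[R]_n.+1).
Variables (F : R -> Prop) (d : 'I_m -> R).
Hypothesis hF : is_subfield F.
Hypothesis d_neq0 : forall b, d b != 0.
Hypothesis Fgram : forall a b, F (d a * gram e a b * d b).

(* The coefficients of the projection of [d j *: e j] along the [e b] with
   [b] in [H] solve a linear system over [F] that is solvable over [R]. *)
Lemma rational_projection (H : pred 'I_m) j w (alpha : 'I_m -> R) :
  e j = w + \sum_(b | H b) alpha b *: e b ->
  (forall b, H b -> lor w (e b) = 0) ->
  exists U z : 'I_m -> R, [/\ forall b, F (U b),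
    \sum_b (U b * d b) *: e b = d j *: w + \sum_(b | H b) z b *: e b &
    forall b, H b -> lor (\sum_a (U a * d a) *: e a) (e b) = 0].
Proof.
move=> ejE w0.
pose toF x : subfield_type hF := insubd 0 x.
have toFK x : F x -> val (toF x) = x.
  by move=> Fx; rewrite insubdK //; apply/in_subfield_pred.
pose AF : 'M[subfield_type hF]_m := \matrix_(a, b)
  (if H a && H b then toF (d a * gram e a b * d b) else 0).
pose rF : 'rV[subfield_type hF]_m := \row_b
  (if H b then toF (d j * gram e j b * d b) else 0).
(* The real solution is [alpha] rescaled by [d]. Membership in a row space descends to the subfield,
   which gives a solution [a] over [F]. *)
have : (map_mx val rF <= map_mx val AF)%MS.
  apply/submxP; exists (\row_a (d j * alpha a / d a)).
  apply/rowP => b; rewrite !mxE.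
  case: ifP => Hb; last first.
    by rewrite rmorph0 big1 // => a _; rewrite !mxE Hb andbF rmorph0 mulr0.
  rewrite toFK // /gram [X in d j * lor X _ * _]ejE lorDl w0 // add0r lor_suml.
  rewrite mulr_sumr mulr_suml big_mkcond; apply: eq_bigr => a _; rewrite !mxE Hb andbT.
  case: (H a); last by rewrite rmorph0 mulr0.
  by rewrite toFK // lorZl /gram; field.
rewrite map_submx => /submxP[a aE].
pose aR b := if H b then val (a 0 b) else 0.
pose U b := (b == j)%:R - aR b.
have sumU (g : 'I_m -> 'rV[R]_n.+1) : \sum_b U b * d b *: g b =
    d j *: g j - \sum_(b | H b) (val (a 0 b) * d b) *: g b.
  rewrite [in RHS]big_mkcond (bigD1 j) //= [X in _ - X](bigD1 j) //=.
  rewrite opprD addrA; congr (_ + _).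
    by rewrite /U /aR eqxx; case: ifP => _;
      rewrite ?subr0 ?mul1r // mulrBl mul1r scalerBl.
  rewrite -sumrN; apply: eq_bigr => b /negPf nb; rewrite /U /aR nb sub0r.
  by case: ifP => _; rewrite ?oppr0 ?mul0r ?scale0r // mulNr scaleNr.
(* The solution over [F] may differ from the real one; [z] records the discrepancy. *)
exists U, (fun b => d j * alpha b - val (a 0 b) * d b); split=> //.
- move=> b; apply: (subfieldB hF); first by case: (b == j);
    [exact: (subfield1 hF) | exact: (subfield0 hF)].
  by rewrite /aR; case: ifP => _; [exact: subfield_typeP | exact: subfield0].
- rewrite sumU ejE scalerDr -addrA; congr (_ + _).
  rewrite scaler_sumr -sumrB; apply: eq_bigr => b _.
  by rewrite scalerA scalerBl.
- move=> b Hb; rewrite sumU lorDl lorNl lorZl lor_suml.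
  apply: (mulIf (d_neq0 b)); rewrite mul0r mulrBl -/(gram e j b).
  have := congr1 (fun B : 'rV_m => val (B 0 b)) aE.
  rewrite !mxE Hb toFK // => ->.
  have -> : val (\sum_l a 0 l * AF l b) = \sum_l val (a 0 l) * val (AF l b).
    by rewrite rmorph_sum; apply: eq_bigr => l _; exact: rmorphM.
  rewrite mulr_suml [X in _ - X]big_mkcond /= -sumrB big1 // => l _.
  rewrite mxE Hb andbT.
  case: (H l); last by rewrite rmorph0 mulr0 subr0.
  by rewrite toFK // lorZl /gram; ring.
Qed.

Variables (k : nat) (I : {set 'I_m}) (M : 'M[R]_(k.+1, n.+1)).
Hypothesis face_dim : span_dim (face_set e I) k.+1.
Hypothesis chart : chart_of M (face_set e I).

(** The vectors from [rational_projection] are multiples of the face normals up to combinations of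
    the [e b] orthogonal to them; these drop out of pairings, leaving [q j = c j / d (idx j)]. *)
Lemma scaled_face_gram (T : finType) (idx : T -> 'I_m) (f : T -> 'rV[R]_k.+1) :
  (forall j, face_normal M (e (idx j)) (f j)) ->
  exists (q : T -> R) (U : T -> 'I_m -> R), (forall j b, F (U j b)) /\
    forall i j, gram f i j = q i * q j *
      \sum_a \sum_b U i a * (d a * gram e a b * d b) * U j b.
Proof.
move=> fP; have [iso _ _] := chart.
pose H : pred 'I_m := fun b => `[< face_hyperplane e I b >].
have /choice[c /choice[U /choice[z P]]] : forall j, exists c (U z : 'I_m -> R),
    [/\ 0 < c, forall b, F (U b),
      \sum_b (U b * d b) *: e b =
        (d (idx j) / c) *: (f j *m M) + \sum_(b | H b) z b *: e b,
      forall b, H b -> lor (\sum_a (U a * d a) *: e a) (e b) = 0 &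
      forall b, H b -> lor (f j *m M) (e b) = 0].
  move=> j; have := face_normal_decomposition face_dim chart (fP j).
  case=> c [alpha [w [c0 wE ejE w0]]].
  have {}w0 b : H b -> lor w (e b) = 0 by move=> /asboolP; exact: w0.
  have [U [z [FU UE U0]]] := rational_projection ejE w0.
  exists c, U, z; split=> // [|b /asboolP hb].
    by rewrite UE wE scalerA.
  exact: (chart_orthogonal face_dim chart).
exists (fun j => c j / d (idx j)), U; split=> [j b|i j]; first by case: (P j).
have [ci FUi ui ui0 wi0] := P i; have [cj FUj uj uj0 wj0] := P j.
have <- : lor (\sum_b (U i b * d b) *: e b) (\sum_b (U j b * d b) *: e b) =
    \sum_a \sum_b U i a * (d a * gram e a b * d b) * U j b.
  rewrite lor_suml; apply: eq_bigr => a _; rewrite lor_sumr; apply: eq_bigr => b _.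
  by rewrite lorZl lorZr /gram; ring.
rewrite {1}uj lorDr lor_sumr [X in _ * (_ + X)]big1 => [|b Hb]; last first.
  by rewrite lorZr ui0 ?mulr0.
rewrite addr0 ui lorDl lor_suml [X in _ * (_ + X)]big1 => [|b Hb]; last first.
  by rewrite lorZl lorZr lorC wj0 // !mulr0.
rewrite addr0 lorZl lorZr iso /gram.
by field; rewrite !d_neq0 !gt_eqF.
Qed.

End ScaledGram.

(** * Positive semidefinite matrices *)

Section Psd.
Variables (R : realType) (T : finType).

(** The new form at [c] is the form of [A] at the combination of the rows of [V] with coefficients
    [c]. *)
Lemma psd_congruence (T' : finType) (A : T -> T -> R) (V : T' -> T -> R) :
  psd A -> psd (fun i j => \sum_a \sum_b V i a * A a b * V j b).
Proof.
move=> psdA c; have := psdA (fun a => \sum_i c i * V i a).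
congr (0 <= _); symmetry.
rewrite (eq_bigr (fun i => \sum_a \sum_j \sum_b
    c i * (V i a * A a b * V j b) * c j)) => [|i _]; last first.
  rewrite exchange_big /=; apply: eq_bigr => j _.
  rewrite mulr_sumr mulr_suml; apply: eq_bigr => a _.
  by rewrite mulr_sumr mulr_suml.
rewrite exchange_big /=; apply: eq_bigr => a _.
rewrite (eq_bigr (fun i => \sum_b \sum_j
    c i * (V i a * A a b * V j b) * c j)) => [|i _]; last exact: exchange_big.
rewrite exchange_big /=; apply: eq_bigr => b _.
rewrite !mulr_suml; apply: eq_bigr => i _; rewrite mulr_sumr.
by apply: eq_bigr => j _; ring.
Qed.

Lemma psd_diag (A : T -> T -> R) j : psd A -> 0 <= A j j.
Proof.
move=> /(_ (fun i => (i == j)%:R)); rewrite (bigD1 j) //= [X in _ + X]big1.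
  rewrite addr0 (bigD1 j) //= big1 ?addr0 ?eqxx ?mul1r ?mulr1 //.
  by move=> i /negPf ->; rewrite mulr0.
by move=> i /negPf ni; rewrite big1 // => l _; rewrite ni !mul0r.
Qed.

Lemma psd_scale (A B : T -> T -> R) (t : T -> R) :
  (forall i j, B i j = t i * A i j * t j) -> psd A -> psd B.
Proof.
move=> BE psdA c; have := psdA (fun i => c i * t i).
congr (0 <= _); apply: eq_bigr => i _; apply: eq_bigr => j _.
by rewrite BE; ring.
Qed.

End Psd.

(** * The fields attached to a Gram matrix *)

Section GramFields.
Variables (R : realType) (T : finType) (n : nat) (g : T -> 'rV[R]_n.+1).

Lemma ground_subfield :
  is_subfield (ground_field g).
Proof. exact: gen_field_subfield. Qed.

Lemma Ftilde_subfield :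
  is_subfield (Ftilde g).
Proof. exact: gen_field_subfield. Qed.

Lemma Ftilde_gram i j :
  Ftilde g (gram g i j).
Proof. by apply: gen_field_incl; exists i, j. Qed.

Lemma ground_sub_Ftilde x :
  ground_field g x -> Ftilde g x.
Proof.
apply: gen_field_min; first exact: Ftilde_subfield.
move=> _ [s [_ ->]]; apply: (subfield_prod Ftilde_subfield) => i.
exact: Ftilde_gram.
Qed.

Lemma gram_switching : exists t : T -> R, [/\ forall i, t i != 0,
  forall i, Ftilde g (t i) & forall i j, ground_field g (t i * gram g i j * t j)].
Proof.
apply: switching.
- by move=> i j; rewrite /gram lorC.
- exact: ground_subfield.
- exact: Ftilde_subfield.
- by move=> c c0; apply: gen_field_incl; exists c.
- exact: Ftilde_gram.
Qed.

End GramFields.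

(** * Transfer of field conditions from the polytope to the face *)

Section Transfer.
Variables (R : realType) (n k : nat) (T T' : finType).
Variables (e : T -> 'rV[R]_n.+1) (f : T' -> 'rV[R]_k.+1).
Variables (d : T -> R) (q : T' -> R) (U : T' -> T -> R).
Hypothesis f_unit : unit_normals f.
Hypothesis e_real : totally_real (Ftilde e).
Hypothesis e_psd : forall s : R -> R, field_emb (Ftilde e) s ->
  (exists x, ground_field e x /\ s x != x) -> psd (fun i j => s (gram e i j)).
Hypothesis Fd : forall b, Ftilde e (d b).
Hypothesis Fgram : forall a b, ground_field e (d a * gram e a b * d b).
Hypothesis FU : forall j b, ground_field e (U j b).

Let P i j := \sum_a \sum_b U i a * (d a * gram e a b * d b) * U j b.
Hypothesis gramE : forall i j, gram f i j = q i * q j * P i j.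

Let hF : is_subfield (ground_field e) := ground_subfield e.
Let hFt : is_subfield (Ftilde e) := Ftilde_subfield e.

Lemma ground_P i j : ground_field e (P i j).
Proof.
apply: (subfield_sum hF) => a; apply: (subfield_sum hF) => b.
by apply: (subfieldM hF) => //; apply: (subfieldM hF).
Qed.

Lemma q_sqr j : q j ^+ 2 * P j j = 1.
Proof. by rewrite expr2 -gramE; exact: f_unit. Qed.

Lemma q_sqrE j : q j ^+ 2 = (P j j)^-1.
Proof.
have PE := q_sqr j; apply: (mulIf (x := P j j)); last first.
  by rewrite PE mulVf //; apply: contra_eq_neq PE => ->; rewrite mulr0 eq_sym oner_eq0.
by apply: contra_eq_neq PE => ->; rewrite mulr0 eq_sym oner_eq0.
Qed.

(** In a cyclic product each index occurs once as a row and once as a column, so the [q i] enter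
    only through their squares, which lie in the ground field of [e]. *)
Lemma face_ground_sub x : ground_field f x -> ground_field e x.
Proof.
apply: gen_field_min => // _ [s [_ ->]].
have -> : cyc_prod (gram f) s =
    \prod_(i <- s) q i ^+ 2 * \prod_(p <- zip s (rot 1 s)) P p.1 p.2.
  rewrite /cyc_prod (eq_bigr (fun p => q p.1 * q p.2 * P p.1 p.2)) => [|p _];
    last exact: gramE.
  rewrite !big_split /=; congr (_ * _).
  have sz : size s = size (rot 1 s) by rewrite size_rot.
  have E1 : \prod_(p <- zip s (rot 1 s)) q p.1 = \prod_(i <- s) q i.
    by rewrite -(big_map fst predT q) -/(unzip1 _) unzip1_zip ?sz.
  have E2 : \prod_(p <- zip s (rot 1 s)) q p.2 = \prod_(i <- s) q i.
    rewrite -(big_map snd predT q) -/(unzip2 _) unzip2_zip ?sz //.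
    by apply: perm_big; rewrite perm_rot.
  by rewrite E1 E2 -big_split.
apply: (subfieldM hF); last by apply: (subfield_prod hF) => p; exact: ground_P.
apply: (subfield_prod hF) => j.
by rewrite q_sqrE; apply: (subfieldV hF); exact: ground_P.
Qed.

Lemma Ftilde_algebraic x : Ftilde e x -> algebraicOver (ratr : rat -> R) x.
Proof. by apply: number_field_algebraic => //; case: e_real. Qed.

Lemma q_algebraic j : algebraicOver (ratr : rat -> R) (q j).
Proof.
apply/algebraic_sqrt/Ftilde_algebraic; rewrite q_sqrE.
by apply: (subfieldV hFt); apply: ground_sub_Ftilde; exact: ground_P.
Qed.

Lemma face_gram_algebraic i j : algebraicOver (ratr : rat -> R) (gram f i j).
Proof.
rewrite gramE; apply: algebraic_mul.
  by apply: algebraic_mul; exact: q_algebraic.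
by apply: Ftilde_algebraic; apply: ground_sub_Ftilde; exact: ground_P.
Qed.

Local Notation C := (complex.complex R).
Local Notation toC := (@complex.real_complex R).

(* [q j] is a square root of the inverse of [P j j], and the conjugates of
   [P j j] are nonnegative by the semidefiniteness hypothesis. *)
Lemma extend_real (L : R -> Prop) (s : R -> C) : is_subfield L ->
  field_emb L s -> exists (K : R -> Prop) (r : R -> R),
  [/\ is_subfield K, field_emb K r, forall x, Ftilde e x -> K x,
    forall x, Ftilde f x -> K x &
    (forall x, L x -> K x -> s x = toC (r x)) /\
    ((exists x, ground_field e x /\ r x != x) ->
      psd (fun i j => r (gram f i j)))].
Proof.
move=> hL hs; have [[N [b [Fb bsp]]] rl] := e_real.
(* Adjoining a rational spanning family of [Ftilde e] and all the [q j] yields a field that also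
   contains the Gram matrix of [f]. *)
pose xs := [seq b i | i <- enum 'I_N] ++ [seq q j | j <- enum T'].
have [x|L' [hL' sub _ _ ext]] := adjoin_seq hL (xs := xs).
  rewrite mem_cat => /orP[] /mapP[i _ ->]; last exact: q_algebraic.
  exact: Ftilde_algebraic.
have [s' [hs' s'E]] := ext C s hs.
have FL' x : Ftilde e x -> L' x.
  move=> /bsp[c ->]; apply: (subfield_sum hL') => i; apply: (subfieldM hL').
    exact: subfield_rat.
  by apply: sub; right; rewrite mem_cat map_f ?mem_enum.
have qL' j : L' (q j) by apply: sub; right; rewrite mem_cat map_f ?mem_enum ?orbT.
pose r x := complex.Re (s' x).
(* The elements with real image form a subfield, on which [r] is a real embedding. *)
pose K x := L' x /\ s' x = toC (r x).
have KP x a : L' x -> s' x = toC a -> K x by move=> Lx sx; split=> //; rewrite /r sx.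
have hK : is_subfield K.
  split.
  - by apply: (KP _ 0); [exact: subfield0 | rewrite (emb0 hL' hs') rmorph0].
  - by apply: (KP _ 1); [exact: subfield1 | rewrite (emb1 hs') rmorph1].
  - move=> x y [Lx sx] [Ly sy]; split.
    + apply: (KP _ (r x + r y)); first exact: subfieldD.
      by rewrite (embD hs') // sx sy rmorphD.
    + apply: (KP _ (- r x)); first exact: subfieldN.
      by rewrite (embN hL' hs') // sx rmorphN.
    + apply: (KP _ (r x * r y)); first exact: subfieldM.
      by rewrite (embM hs') // sx sy rmorphM.
  - move=> x [Lx sx] _; apply: (KP _ (r x)^-1); first exact: subfieldV.
    by rewrite (embV hL' hs') // sx fmorphV.
have hr : field_emb K r.
  split; first by rewrite /r (emb1 hs').
  move=> x y [Lx sx] [Ly sy]; split; rewrite {1}/r.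
    by rewrite (embD hs') // sx sy -rmorphD.
  by rewrite (embM hs') // sx sy -rmorphM.
have FK x : Ftilde e x -> K x.
  move=> Fx; have Lx := FL' x Fx.
  have im : complex.Im (s' x) = 0 by apply: rl Fx; exact: field_emb_sub hs'.
  by apply: (KP _ (r x)) => //; rewrite /r; move: im; case: (s' x) => a c /= ->.
have GK x : ground_field e x -> K x by move=> /ground_sub_Ftilde; exact: FK.
pose V i a := r (U i a) * r (d a).
have rP i j : r (P i j) = \sum_a \sum_b V i a * r (gram e a b) * V j b.
  have KU l a : K (U l a) by exact: GK.
  have Kd a : K (d a) by exact: FK.
  have Kg a c : K (gram e a c) by apply: FK; exact: Ftilde_gram.
  have KM := subfieldM hK; have rM := embM hr.
  have K5 a c : K (U i a * (d a * gram e a c * d c) * U j c).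
    by repeat first [exact: KU | exact: Kd | exact: Kg | apply: (KM)].
  have r5 a c : r (U i a * (d a * gram e a c * d c) * U j c) =
      r (U i a) * (r (d a) * r (gram e a c) * r (d c)) * r (U j c).
    rewrite !rM;
      by repeat first [reflexivity | exact: KU | exact: Kd | exact: Kg | apply: (KM)].
  rewrite /P (emb_sum hK hr) => [|a]; last exact: (subfield_sum hK).
  apply: eq_bigr => a _; rewrite (emb_sum hK hr) //.
  by apply: eq_bigr => c _; rewrite r5 /V; ring.
have Fr : field_emb (Ftilde e) r by exact: field_emb_sub hr.
have psdP : (exists x, ground_field e x /\ r x != x) -> psd (fun i j => r (P i j)).
  move=> mv c; have := psd_congruence V (e_psd Fr mv) c; congr (0 <= _).
  apply: eq_bigr => i _; apply: eq_bigr => j _.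
  by rewrite rP.
(* Either [r] moves the ground field and semidefiniteness applies, or it fixes [P j j], the inverse
   of a square. *)
have P0 j : 0 <= r (P j j).
  have [mv|nmv] := pselect (exists x, ground_field e x /\ r x != x).
    exact: (psd_diag j (psdP mv)).
  have -> : r (P j j) = P j j.
    apply: contrapT => /eqP rP'; apply: nmv; exists (P j j); split=> //.
    exact: ground_P.
  by rewrite -invr_ge0 -q_sqrE sqr_ge0.
have qK j : K (q j).
  have Lq := qL' j; have [LP sP] := GK _ (ground_P j j).
  (* The image of [q j] has the same square as a real number, so it is that number up to sign. *)
  have : s' (q j) ^+ 2 = toC (Num.sqrt (r (P j j))^-1) ^+ 2.
    have E1 : s' (P j j)^-1 = toC (r (P j j))^-1.
      by rewrite (embV hL' hs') // sP fmorphV.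
    rewrite -rmorphXn /= sqr_sqrtr ?invr_ge0 //; apply: etrans E1.
    by rewrite -q_sqrE !expr2 (embM hs').
  move/eqP; rewrite eqf_sqr => /orP[] /eqP sq; first exact: KP sq.
  by apply: (KP _ (- Num.sqrt (r (P j j))^-1)) => //; rewrite sq rmorphN.
have PK i j : K (P i j) by apply: GK; exact: ground_P.
exists K, r; split=> //.
  apply: gen_field_min => // _ [i [j ->]]; rewrite gramE.
  by apply: (subfieldM hK) => //; exact: (subfieldM hK).
split=> [x Lx [_ <-]|mv]; first by rewrite s'E.
apply: (psd_scale (t := fun i => r (q i)) _ (psdP mv)) => i j.
rewrite gramE (embM hr) ?(embM hr) //; last exact: (subfieldM hK).
ring.
Qed.

(** The field has finitely many algebraic generators, and [extend_real] makes each of its complex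
    embeddings agree with a real one. *)
Lemma Ftilde_face_totally_real : totally_real (Ftilde f).
Proof.
split=> [|s hs x Fx].
  apply: (@gen_field_number_field _ _
      [seq gram f p.1 p.2 | p <- enum [the finType of (T' * T')%type]]).
    move=> x; split=> [[i [j ->]]|/mapP[p _ ->]]; last by exists p.1, p.2.
    by apply/mapP; exists (i, j); rewrite ?mem_enum.
  by move=> _ [i [j ->]]; exact: face_gram_algebraic.
have [K [r [_ _ _ fK [sE _]]]] := extend_real (Ftilde_subfield f) hs.
by rewrite sE //; exact: fK.
Qed.

Lemma face_psd (s : R -> R) : field_emb (Ftilde f) s ->
  (exists x, ground_field f x /\ s x != x) -> psd (fun i j => s (gram f i j)).
Proof.
move=> hs [x [Fx sx]].
(* The real embedding is viewed as a complex one so that it can be extended; on [Ftilde f] the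
   extension still agrees with [s]. *)
have hs' : field_emb (Ftilde f) (fun x => toC (s x)).
  split=> [|y z Fy Fz]; first by rewrite hs.1 rmorph1.
  by have [-> ->] := hs.2 y z Fy Fz; rewrite rmorphD rmorphM.
have [K [r [_ _ _ fK [sE psdr]]]] := extend_real (Ftilde_subfield f) hs'.
have {}sE y : Ftilde f y -> s y = r y.
  by move=> Fy; apply: (fmorph_inj toC); apply: sE => //; exact: fK.
have : psd (fun i j => r (gram f i j)).
  apply: psdr; exists x; split; first exact: face_ground_sub.
  by rewrite -sE //; exact: ground_sub_Ftilde.
move=> h c; have := h c; congr (0 <= _); apply: eq_bigr => i _.
by apply: eq_bigr => j _; rewrite sE //; exact: Ftilde_gram.
Qed.

(* Otherwise some embedding fixes the ground field of [f] and moves that of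
   [e]; it makes the Gram matrix of [f] semidefinite, but up to rescaling of
   the normals it does not change this matrix. *)
Lemma ground_sub_face x : ~ psd (gram f) -> ground_field e x -> ground_field f x.
Proof.
move=> npsd Fx; apply: contrapT => nfx; apply: npsd.
have hf := ground_subfield f; have hft := Ftilde_subfield f.
have xalg := Ftilde_algebraic (ground_sub_Ftilde Fx).
have [s [hs sE sx]] := adjoin_emb_move hf xalg toC nfx.
have [K [r [hK hr eK fK [srE psdr]]]] := extend_real (adjoin_subfield hf xalg) hs.
have rfix z : ground_field f z -> r z = z.
  move=> Fz; have Kz : K z by apply: fK; exact: ground_sub_Ftilde.
  have : toC (r z) = toC z by rewrite -srE ?sE //; exact: adjoin_base.
  by case.
have rpsd : psd (fun i j => r (gram f i j)).
  apply: psdr; exists x; split=> //; apply: contra_neq sx => rx.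
  rewrite srE ?rx //; first exact: adjoin_gen.
  by apply: eK; exact: ground_sub_Ftilde.
have [t [t0 Kt Ft]] := gram_switching f.
apply: (psd_scale (t := fun i => r (t i) / t i) _ rpsd) => i j.
have Kt' l : K (t l) by exact: fK.
have Kg : K (gram f i j) by apply: fK; exact: Ftilde_gram.
have : r (t i) * r (gram f i j) * r (t j) = t i * gram f i j * t j.
  rewrite -[RHS]rfix // (embM hr) ?(embM hr) //; exact: (subfieldM hK).
move=> E; apply: (mulfI (t0 i)); apply: (mulIf (t0 j)); rewrite -E.
by field; rewrite !t0.
Qed.

End Transfer.

Theorem theorem1p1 (R : realType) (n m k : nat)
  (e : 'I_m -> 'rV[R]_n.+1) (I : {set 'I_m}) (M : 'M[R]_(k.+1, n.+1))
  (f : {j : 'I_m | j \in face_facets e I k} -> 'rV[R]_k.+1) :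
  coxeter_polytope e -> quasi_arithmetic e ->
  (2 <= k)%N -> (k <= n - 1)%N ->
  span_dim (face_set e I) k.+1 ->
  chart_of M (face_set e I) ->
  (forall j, face_normal M (e (val j)) (f j)) ->
  coxeter_polytope f ->
  [/\ coxeter_polytope f, quasi_arithmetic f &
      forall x : R, ground_field f x <-> ground_field e x].
Proof.
move=> _ [_ _ _ e_real e_psd] k2 _ face_dim chart fP cf.
have [[f_unit f_int f_irr] f_vol f_cox] := cf.
have [d [d0 Fd Fgram]] := gram_switching e.
have [q [U [FU gramE]]] :=
  scaled_face_gram (ground_subfield e) d0 Fgram face_dim chart fP.
have npsd : ~ psd (gram f).
  by move=> psdf; exact: psd_not_finite_volume k2 f_int psdf f_vol.
split=> //; last first.
  move=> x; split; first exact: (face_ground_sub f_unit Fgram FU gramE).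
  exact: (ground_sub_face f_unit e_real e_psd Fd Fgram FU gramE).
split=> //.
(* Adjacent facets have intersecting hyperplanes, so the Coxeter condition makes their angle
   [pi / l] with [l >= 2]. *)
- move=> i j [ij [x [[Hx _] xi xj _]]].
  have [|l [l2 ->]] := f_cox i j ij; first by exists x.
  by rewrite ler_wpM2l ?pi_ge0 // lef_pV2 ?posrE ?ltr0n ?ler_nat // (leq_trans _ l2).
- exact: (Ftilde_face_totally_real f_unit e_real e_psd Fd Fgram FU gramE).
- exact: (face_psd f_unit e_real e_psd Fd Fgram FU gramE).
Qed.
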